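(* Let $k\ge3$. For all $2\le\ell\le k$ and all proper partitions $\pi$ of $k$, $\mathrm{Deviation}[\ell]\Rightarrow\mathrm{Expand}_{1/2}[\pi]$. Furthermore, $\mathrm{CliqueDisc}_{1/2}[k-1]\Rightarrow\mathrm{Deviation}[k]$, but no expansion property and no other clique discrepancy property implies $\mathrm{Deviation}[\ell]$ for any $\ell$: for every $2\le\ell\le k$, $\mathrm{Expand}_{1/2}[\pi]\not\Rightarrow\mathrm{Deviation}[\ell]$ for every proper partition $\pi$ of $k$, and $\mathrm{CliqueDisc}_{1/2}[\ell']\not\Rightarrow\mathrm{Deviation}[\ell]$ for every $1\le\ell'\le k-2$. Here $P\Rightarrow Q$ means that every sequence $\{H_n\}_{n\to\infty}$ of $k$-uniform hypergraphs with $|V(H_n)|=n$ satisfying $P$ also satisfies $Q$, and $P\not\Rightarrow Q$ means that some such sequence satisfies $P$ but not $Q$.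
   Context: A $k$-uniform hypergraph $H$ is a pair of finite sets $(V(H),E(H))$ where $E(H)$ is a collection of $k$-subsets of $V(H)$. A proper partition $\pi=k_1+\dots+k_t$ of $k$ is an unordered list of at least two positive integers whose sum is $k$. Let $\{H_n\}_{n\to\infty}$ be a sequence of $k$-uniform hypergraphs with $|V(H_n)|=n$. $\mathrm{Expand}_{1/2}[\pi]$, for $\pi=k_1+\dots+k_t$: for all $S_i\subseteq\binom{V(H_n)}{k_i}$, $1\le i\le t$, $e(S_1,\dots,S_t)=\frac12\prod_{i=1}^t|S_i|+o(n^k)$, where $e(S_1,\dots,S_t)$ is the number of tuples $(s_1,\dots,s_t)$ with $s_i\in S_i$ for all $i$ and $s_1\cup\dots\cup s_t\in E(H_n)$. $\mathrm{CliqueDisc}_{1/2}[\ell]$, for $1\le\ell\le k-1$: for every $\ell$-uniform hypergraph $G$ with $V(G)=V(H_n)$, $|E(H_n)\cap\mathcal{K}_k(G)|=\frac12|\mathcal{K}_k(G)|+o(n^k)$, where $\mathcal{K}_k(G)$ is the collection of $k$-sets $T\subseteq V(G)$ all of whose $\ell$-subsets are edges of $G$. In these two definitions the $o(n^k)$ term is uniform over all choices of the sets $S_i$ (respectively of $G$). $\mathrm{Deviation}[\ell]$, for $2\le\ell\le k$: $$\sum_{\substack{x_1,\dots,x_{k-\ell}\in V(H_n)\\ y_{1,0},y_{1,1},\dots,y_{\ell,0},y_{\ell,1}\in V(H_n)}}(-1)^{|\mathcal{O}[\vec x,\vec y]\cap E(H_n)|}=o(n^{k+\ell}),$$ where $\mathcal{O}[\vec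 x,\vec y]=\{\{x_1,\dots,x_{k-\ell},y_{1,i_1},\dots,y_{\ell,i_\ell}\}:0\le i_j\le1\}$ (the hyperedges of the squashed octahedron; the vertices in the sum are not required to be distinct). *)

(* Defs.v *)
From HB Require Import structures.
From mathcomp Require Import all_boot all_order all_algebra.
From mathcomp Require Import all_classical all_reals all_analysis.

Set Implicit Arguments.
Unset Strict Implicit.
Unset Printing Implicit Defensive.

Import Order.TTheory GRing.Theory Num.Theory.
Import numFieldNormedType.Exports.

Local Open Scope ring_scope.

Definition ksubsets (V : finType) (k : nat) : {set {set V}} :=
  [set A : {set V} | #|A| == k]%N.

Record hypergraph (k : nat) (V : finType) := Hypergraph {
  edges : {set {set V}};
  edges_sub : edges \subset ksubsets V k
}.

Record hypergraph_seq (k : nat) := HypergraphSeq {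
  vertices : nat -> finType;
  card_vertices : forall n : nat, #|vertices n| = n;
  hgraph : forall n : nat, hypergraph k (vertices n)
}.

Arguments vertices {k} _ _.
Arguments hgraph {k} _ _.

Definition seq_implies (k : nat) (P Q : hypergraph_seq k -> Prop) : Prop :=
  forall H : hypergraph_seq k, P H -> Q H.

Definition seq_not_implies (k : nat) (P Q : hypergraph_seq k -> Prop) : Prop :=
  exists H : hypergraph_seq k, P H /\ ~ Q H.

(* A list of parts; the order is irrelevant, since [Expand] below is invariant
   under permutation of the parts. *)
Definition proper_partition (k : nat) (p : seq nat) : bool :=
  [&& (2 <= size p)%N, all (fun i => 0 < i)%N p & sumn p == k].

Definition expand_count (V : finType) (E : {set {set V}}) (t : nat)
    (S : 'I_t -> {set {set V}}) : nat :=
  #|[set s : {ffun 'I_t -> {set V}} |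
      [forall i, s i \in S i] && (\bigcup_i s i \in E)]|.

(* [err] is the error term of order o(n^k); it does not depend on [S]. *)
Definition Expand (R : realType) (k : nat) (p : seq nat)
    (H : hypergraph_seq k) : Prop :=
  exists2 err : nat -> R,
    err =o_eventually (fun n : nat => n%:R ^+ k : R) &
    forall (n : nat) (S : 'I_(size p) -> {set {set vertices H n}}),
      (forall i, S i \subset ksubsets (vertices H n) (nth 0%N p i)) ->
      `| (expand_count (edges (hgraph H n)) S)%:R
         - 2^-1 * \prod_(i < size p) #|S i|%:R | <= err n.

Definition cliques (k l : nat) (V : finType) (G : hypergraph l V) :
    {set {set V}} :=
  [set T in ksubsets V k |
    [forall A : {set V}, (A \in ksubsets V l) && (A \subset T)
                         ==> (A \in edges G)]].

Definition CliqueDisc (R : realType) (k l : nat) (H : hypergraph_seq k) :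
    Prop :=
  exists2 err : nat -> R,
    err =o_eventually (fun n : nat => n%:R ^+ k : R) &
    forall (n : nat) (G : hypergraph l (vertices H n)),
      `| #|edges (hgraph H n) :&: cliques k G|%:R
         - 2^-1 * #|cliques k G|%:R | <= err n.

(* A set of sets, not a multiset: when the vertices [x], [y] are not all
   distinct, coinciding members are counted once. *)
Definition squashed_octahedron (V : finType) (m l : nat)
    (x : {ffun 'I_m -> V}) (y : {ffun 'I_l * bool -> V}) : {set {set V}} :=
  [set [set x i | i : 'I_m] :|: [set y (j, b j) | j : 'I_l]
     | b : {ffun 'I_l -> bool}].

Definition Deviation (R : realType) (k l : nat) (H : hypergraph_seq k) :
    Prop :=
  (fun n : nat =>
     \sum_(x : {ffun 'I_(k - l) -> vertices H n})
       \sum_(y : {ffun 'I_l * bool -> vertices H n})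
         (-1) ^+ #|squashed_octahedron x y :&: edges (hgraph H n)| : R)
  =o_eventually (fun n : nat => n%:R ^+ (k + l) : R).

(* Main.v *)
Require Import Defs.
From HB Require Import structures.
From mathcomp Require Import all_boot all_order all_algebra.
From mathcomp Require Import all_classical all_reals all_analysis.
From mathcomp Require Import ring lra zify.
From mathcomp Require Import fintype finset bigop perm.

Set Implicit Arguments.
Unset Strict Implicit.
Unset Printing Implicit Defensive.

Import Order.TTheory GRing.Theory Num.Theory.
Import numFieldNormedType.Exports.

Local Open Scope ring_scope.

(** Let f be the function on sets of vertices that is -1 on edges and 1
elsewhere. All three properties speak of f through averages over tuples of
vertices, that is, over functions z from a set of k coordinates to the
vertices, with f evaluated at the image of z. Expand and CliqueDisc say that
f is asymptotically orthogonal to certain products of bounded functions, each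
of which ignores some coordinate; Deviation says that the 2^l-th power of the
box norm of f in l coordinates, averaged over the other k - l coordinates,
tends to 0. Tuples with a repeated vertex have density O(1/n), so the
degenerate octahedra and the degenerate tuples never matter.

Deviation implies Expand by the Gowers-Cauchy-Schwarz inequality
[gowers_cauchy_schwarz]: doubling l coordinates one at a time bounds the
2^l-th power of the correlation of f with a product of l functions, the j-th
of which ignores the j-th doubled coordinate, by the box average of f. The
test function of a partition with at least two parts splits as a product of
two factors, one seeing only the first block and one ignoring it, so it has
this form as soon as l >= 2, with two doubled coordinates in different blocks.

CliqueDisc for k - 1 implies Deviation for k by a converse argument. Fix one
of the two vertices in each pair of an octahedron, and regard the average as
one over the opposite corner: each other corner ignores at least one
coordinate of it. Splitting according to the edge pattern of the other corners
leaves the correlation of f with products of indicators, the j-th ignoring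
coordinate j. Restricted to tuples that are rainbow for a colouring of the
vertices by the coordinates, such a product is the indicator of the k-cliques
of a (k-1)-graph ([sum_good]), and a given injective tuple is rainbow for a
proportion k^-k of the colourings ([avg_colourful]).

For the negative part, choose a random sign rho for each (k-1)-set, split the
vertices into two halves, and let f(T) be the product of the signs of the
facets T minus v, where v ranges over the vertices of T in the second half if
there are exactly two of these, and over all of T otherwise. A first moment
computation gives signs with small box norm in all k - 1 coordinates
([exists_quasirandom_signs]), so these signs correlate with no product of
functions of fewer variables. In every case at least two facets are
multiplied; an Expand test or a CliqueDisc test for l' <= k - 2 restricts to a
product of functions of fewer variables on at least one of these facets, and
is therefore defeated ([tests_bound]). But on tuples with exactly two
coordinates a and b in the second half f is a product of a function ignoring a
and a function ignoring b, so it correlates with such products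
([correlated_products]), and Gowers-Cauchy-Schwarz shows that no Deviation
property holds. *)

(** * Averages over finite types *)
Section Average.
Variable R : realFieldType.
Implicit Types T U : finType.

Definition avg T (f : T -> R) : R := #|T|%:R^-1 * \sum_x f x.

Lemma eq_avg T (f g : T -> R) : f =1 g -> avg f = avg g.
Proof. by move=> fg; rewrite /avg; under eq_bigr do rewrite fg. Qed.

Lemma avg_const T (c : R) : (0 < #|T|)%N -> avg (fun _ : T => c) = c.
Proof.
move=> T0; rewrite /avg sumr_const -[c *+ _]mulr_natl mulKf //.
by rewrite pnatr_eq0 -lt0n.
Qed.

Lemma avgZ T (c : R) (f : T -> R) : avg (fun x => c * f x) = c * avg f.
Proof. by rewrite /avg -mulr_sumr mulrCA. Qed.

Lemma avgD T (f g : T -> R) : avg (fun x => f x + g x) = avg f + avg g.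
Proof. by rewrite /avg big_split mulrDr. Qed.

Lemma avgB T (f g : T -> R) : avg (fun x => f x - g x) = avg f - avg g.
Proof. by rewrite /avg sumrB mulrBr. Qed.

Lemma avg_sum T (J : finType) (f : J -> T -> R) :
  avg (fun x => \sum_j f j x) = \sum_j avg (f j).
Proof. by rewrite /avg exchange_big /= mulr_sumr. Qed.

Lemma avg_exchange T U (f : T -> U -> R) :
  avg (fun x => avg (f x)) = avg (fun y => avg (fun x => f x y)).
Proof. by rewrite /avg -!mulr_sumr exchange_big /= mulrCA. Qed.

Lemma avg_pair T U (f : T * U -> R) :
  avg f = avg (fun x => avg (fun y => f (x, y))).
Proof.
rewrite /avg card_prod natrM invfM -!mulr_sumr mulrA; congr (_ * _).
by rewrite pair_bigA; apply: eq_bigr => -[].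
Qed.

Lemma avg_bij T U (h : T -> U) (f : U -> R) :
  bijective h -> avg (fun x => f (h x)) = avg f.
Proof.
move=> bh; rewrite /avg (bij_eq_card bh); congr (_ * _).
by rewrite [RHS](reindex h) //=; apply: onW_bij.
Qed.

Lemma ler_avg T (f g : T -> R) : (forall x, f x <= g x) -> avg f <= avg g.
Proof.
by move=> fg; rewrite /avg ler_wpM2l ?invr_ge0 ?ler0n // ler_sum.
Qed.

Lemma avg_ge0 T (f : T -> R) : (forall x, 0 <= f x) -> 0 <= avg f.
Proof. by move=> f0; rewrite mulr_ge0 ?invr_ge0 ?ler0n // sumr_ge0. Qed.

Lemma ler_norm_avg T (f : T -> R) : `|avg f| <= avg (fun x => `|f x|).
Proof.
by rewrite /avg normrM ger0_norm ?invr_ge0 ?ler0n // ler_wpM2l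
  ?invr_ge0 ?ler0n // ler_norm_sum.
Qed.

Lemma exists_le_avg T (f : T -> R) :
  (0 < #|T|)%N -> exists x, f x <= avg f.
Proof.
move=> T0; apply/existsP; rewrite -[X in is_true X]negbK negb_exists.
apply/negP => /forallP fx.
have /card_gt0P[x0 _] := T0.
have : avg (fun _ : T => avg f) < avg f.
  rewrite {1 3}/avg ltr_pM2l ?invr_gt0 ?ltr0n //.
  apply: (@ltr_sum _ _ (index_enum T) xpredT).
    by apply/hasP; exists x0; rewrite ?mem_index_enum.
  by move=> x _; rewrite ltNge.
by rewrite avg_const // ltxx.
Qed.

(** Cauchy-Schwarz, as the nonnegativity of the variance. *)
Lemma avg_sqr T (f : T -> R) : avg f ^+ 2 <= avg (fun x => f x ^+ 2).
Proof.
have [T0|T0] := posnP #|T|.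
  by rewrite /avg T0 invr0 !mul0r expr0n.
have : 0 <= avg (fun x => (f x - avg f) ^+ 2).
  by apply: avg_ge0 => x; apply: sqr_ge0.
rewrite (@eq_avg _ _ (fun x => f x ^+ 2 - (2 * avg f) * f x + avg f ^+ 2)); last first.
  by move=> x; rewrite sqrrB -mulr_natl; ring.
rewrite avgD avgB avgZ avg_const //.
lra.
Qed.

End Average.

(** * Resampling one coordinate of a tuple *)
Section Resampling.
Variables (R : realFieldType) (V : finType).
Implicit Types (I : finType).

Definition upd I (z : {ffun I -> V}) (j : I) (a : V) : {ffun I -> V} :=
  [ffun i => if i == j then a else z i].

Definition ignores I T (j : I) (w : {ffun I -> V} -> T) :=
  forall z a, w (upd z j a) = w z.

(** Valued in [R], so that it can be averaged as an error term. *)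
Definition noninj I (z : {ffun I -> V}) : R := (~~ injectiveb z)%:R.

Lemma updE I (z : {ffun I -> V}) j a i :
  upd z j a i = if i == j then a else z i.
Proof. by rewrite ffunE. Qed.

Lemma upd_same I (z : {ffun I -> V}) j : upd z j (z j) = z.
Proof. by apply/ffunP => i; rewrite updE; case: eqP => [->|]. Qed.

Lemma upd_upd I (z : {ffun I -> V}) j a b : upd (upd z j a) j b = upd z j b.
Proof. by apply/ffunP => i; rewrite !updE; case: eqP. Qed.

Lemma updC I (z : {ffun I -> V}) i j a b :
  i != j -> upd (upd z i a) j b = upd (upd z j b) i a.
Proof.
move=> ij; apply/ffunP => q; rewrite !updE.
by case: (eqVneq q j) => // ->; rewrite eq_sym (negPf ij).
Qed.

(** The map exchanging the new value with the value it overwrites is an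
involution of pairs (tuple, value). *)
Lemma avg_resample I (j : I) (f : {ffun I -> V} -> R) :
  avg (fun z => avg (fun a => f (upd z j a))) = avg f.
Proof.
have [V0|V0] := posnP #|V|.
  have noz (z : {ffun I -> V}) : False by have := card0_eq V0 (z j).
  by rewrite /avg !(@big_pred0 _ _ _ {ffun I -> V}) // => z; have := noz z.
rewrite -(avg_pair (fun p => f (upd p.1 j p.2))).
pose h (p : {ffun I -> V} * V) := (upd p.1 j p.2, p.1 j).
have hK : involutive h.
  by case=> z a; rewrite /h /= upd_upd upd_same updE eqxx.
rewrite -(@avg_bij _ _ _ h); last by apply: inv_bij.
rewrite avg_pair; apply: eq_avg => z.
rewrite (@eq_avg _ _ _ (fun _ => f z)) ?avg_const // => a /=.
by rewrite upd_upd upd_same.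
Qed.

(** A union bound: resampling coordinate i shows that coordinates i and j
collide with probability 1 / #|V|. *)
Lemma avg_noninj I : (0 < #|V|)%N ->
  avg (@noninj I) <= #|I|%:R ^+ 2 / #|V|%:R.
Proof.
move=> V0.
have pairbound (p : I * I) : p.1 != p.2 ->
    avg (fun z : {ffun I -> V} => (z p.1 == z p.2)%:R : R) = #|V|%:R^-1.
  case: p => i j /= ij; rewrite -(avg_resample i).
  have ji : (j == i) = false by rewrite eq_sym (negPf ij).
  rewrite (@eq_avg _ _ _ (fun=> #|V|%:R^-1)); last first.
    move=> z; rewrite /avg (bigD1 (z j)) //= !updE eqxx ji eqxx.
    rewrite big1 ?addr0 ?mulr1 // => a azj.
    by rewrite !updE eqxx ji (negPf azj).
  by rewrite avg_const // card_ffun expn_gt0 V0.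
have : avg (@noninj I) <= avg (fun z : {ffun I -> V} => \sum_(p : I * I)
         if p.1 != p.2 then (z p.1 == z p.2)%:R else 0 : R).
  apply: ler_avg => z; rewrite /noninj.
  case: injectiveP => //= inj.
    by rewrite sumr_ge0 // => p _; case: ifP.
  have [i [j [ij zij]]] : exists i j, i != j /\ z i = z j.
    apply: contrapT => H; apply: inj => i j zij; apply/eqP/negPn/negP => ij.
    by apply: H; exists i, j.
  rewrite (bigD1 (i, j)) //= ij zij eqxx lerDl sumr_ge0 // => p _.
  by case: ifP.
move=> /le_trans; apply; rewrite avg_sum.
rewrite expr2 -natrM -(card_prod I I) mulr_natl -sumr_const.
apply: ler_sum => p _; case: (p.1 != p.2) (pairbound p) => [->|_] //.
by rewrite /avg big1 // mulr0 invr_ge0 ler0n.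
Qed.

End Resampling.

(** * The box average and the Gowers-Cauchy-Schwarz inequality *)
Section GowersCauchySchwarz.
Variables (R : realFieldType) (V : finType).

(** One doubling step, where [c'] is a fresh copy of the coordinate [c]. Since
[w] ignores [c], only the average of [A] over [c] matters, and the square of
that average is the average of [A] at two independent values, for which the
coordinates [c] and [c'] serve. *)
Lemma cauchy_schwarz_step (K : finType) (c c' : K) (w A : {ffun K -> V} -> R) :
  c != c' -> ignores c w -> ignores c' A -> (forall z, `|w z| <= 1) ->
  avg (fun z => w z * A z) ^+ 2 <= avg (fun z => A z * A (upd z c (z c'))).
Proof.
move=> cc' wc Ac' w1.
have c'c : (c' == c) = false by rewrite eq_sym (negPf cc').
pose G z := avg (fun a => A (upd z c a)).
have Gc' : ignores c' G.
  move=> z b; apply: eq_avg => a.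
  by rewrite updC ?Ac' // eq_sym.
have -> : avg (fun z => w z * A z) = avg (fun z => w z * G z).
  rewrite -(avg_resample c); apply: eq_avg => z; rewrite -avgZ.
  by apply: eq_avg => a; rewrite wc.
have -> : avg (fun z => A z * A (upd z c (z c'))) = avg (fun z => G z ^+ 2).
  transitivity (avg (fun z => G z * A (upd z c (z c')))).
    rewrite -(avg_resample c); apply: eq_avg => z.
    rewrite mulrC -avgZ; apply: eq_avg => a.
    by rewrite upd_upd updE c'c mulrC.
  rewrite -(avg_resample c'); apply: eq_avg => z.
  rewrite expr2 -[X in _ = _ * X]/(avg _) -avgZ; apply: eq_avg => b.
  by rewrite Gc' updE eqxx updC ?Ac' // eq_sym.
apply: le_trans (avg_sqr _) _; apply: ler_avg => z.
rewrite exprMn ler_piMl ?sqr_ge0 //.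
by rewrite -[w z ^+ 2]ger0_norm ?sqr_ge0 // normrX exprn_ile1.
Qed.

Variable I : finType.
Implicit Types (D B : {set I}) (z : {ffun I * bool -> V}).

(** Each coordinate carries two values; a corner takes the second value on
[B] and the first one elsewhere. *)
Definition corner B z : {ffun I -> V} := [ffun i => z (i, i \in B)].

(** The [2 ^ #|D|]-th power of the box norm of [phi] in the coordinates of
[D], averaged over the remaining coordinates, whose second values are
dummies. *)
Definition box (phi : {ffun I -> V} -> R) D : R :=
  avg (fun z => \prod_(B : {set I} | B \subset D) phi (corner B z)).

Lemma corner_upd B z j b a :
  corner B (upd z (j, b) a) =
  if (j \in B) == b then upd (corner B z) j a else corner B z.
Proof.
apply/ffunP => i; rewrite (fun_if (fun f : {ffun I -> V} => f i)) !ffunE xpair_eqE.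
by case: (eqVneq i j) => [->|ij] /=; case: eqP.
Qed.

Lemma corner_setU1 B z j : j \notin B ->
  corner (j |: B) z = corner B (upd z (j, false) (z (j, true))).
Proof.
move=> jB; apply/ffunP => i; rewrite !ffunE xpair_eqE !inE.
by case: (eqVneq i j) => [->|ij] /=; rewrite ?(negPf jB).
Qed.

Lemma prod_subsets_setU1 D j (F : {set I} -> R) : j \notin D ->
  \prod_(B : {set I} | B \subset j |: D) F B =
  (\prod_(B : {set I} | B \subset D) F B)
  * \prod_(B : {set I} | B \subset D) F (j |: B).
Proof.
move=> jD; rewrite (bigID (fun B : {set I} => j \notin B)) /=; congr (_ * _).
  apply: eq_bigl => B; apply/andP/idP => [[BD jB]|BD].
    apply/subsetP => i iB; have /setU1P[ij|//] := subsetP BD i iB.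
    by rewrite -ij iB in jB.
  split; first by apply: subset_trans BD (subsetU1 _ _).
  by apply: contra jD => /(subsetP BD).
rewrite (reindex_onto (fun B : {set I} => j |: B) (fun B => B :\ j)) /=; last first.
  by move=> B /andP[_ /negPn jB]; rewrite setD1K.
apply: eq_bigl => B; rewrite setU11 andbT.
apply/andP/idP => [[jBD /eqP BE]|BD].
  have jB : j \notin B by rewrite -BE setU1K ?setD11 // -BE setD11.
  apply/subsetP => i iB.
  have /setU1P[ij|//] := subsetP jBD i (setU1r _ iB).
  by rewrite -ij iB in jB.
have jB : j \notin B by apply: contra jD => /(subsetP BD).
by rewrite setUS // setU1K.
Qed.

(** The coordinates of [s] are doubled one after the other; those of [D] are
already doubled. *)
Lemma gowers_cauchy_schwarz_seq (s : seq I) D phi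
    (u : I -> {ffun I -> V} -> R) :
  uniq s -> {in s, forall j, j \notin D} -> {in s, forall j, ignores j (u j)} ->
  (forall j x, `|u j x| <= 1) ->
  box (fun x => phi x * \prod_(j <- s) u j x) D ^+ (2 ^ size s)
  <= box phi (D :|: [set j in s]).
Proof.
move=> + + + u1; elim: s D => [|j s IH] D /=.
  move=> _ _ _; rewrite expr1 setU0; apply: ler_avg => z.
  by under eq_bigr do rewrite big_nil mulr1.
move=> /andP[js us] sD su.
have jD : j \notin D by apply: sD; rewrite mem_head.
have -> : D :|: [set i in j :: s] = (j |: D) :|: [set i in s].
  by apply/setP => i; rewrite !inE orbCA orbA.
apply: le_trans (IH (j |: D) us _ _); first last.
- by move=> i si; apply: su; rewrite inE si orbT.
- move=> i si; rewrite !inE negb_or sD ?inE ?si ?orbT // andbT.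
  by apply: contraNneq js => <-.
suff le_sqr : box (fun x => phi x * \prod_(i <- j :: s) u i x) D ^+ 2
              <= box (fun x => phi x * \prod_(i <- s) u i x) (j |: D).
  rewrite expnS exprM; apply: lerXn2r => //; rewrite nnegrE ?sqr_ge0 //.
  exact: le_trans (sqr_ge0 _) le_sqr.
pose A z := \prod_(B : {set I} | B \subset D)
  (phi (corner B z) * \prod_(i <- s) u i (corner B z)).
pose w z := \prod_(B : {set I} | B \subset D) u j (corner B z).
have -> : box (fun x => phi x * \prod_(i <- j :: s) u i x) D
        = avg (fun z => w z * A z).
  apply: eq_avg => z; rewrite -big_split; apply: eq_bigr => B _ /=.
  by rewrite big_cons mulrCA.
have jB B : B \subset D -> j \notin B.
  by move=> BD; apply: contra jD => /(subsetP BD).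
have -> : box (fun x => phi x * \prod_(i <- s) u i x) (j |: D)
        = avg (fun z => A z * A (upd z (j, false) (z (j, true)))).
  apply: eq_avg => z; rewrite prod_subsets_setU1 //; congr (_ * _).
  by apply: eq_bigr => B BD; rewrite corner_setU1 ?jB.
apply: cauchy_schwarz_step.
- by rewrite xpair_eqE andbF.
- move=> z a; apply: eq_bigr => B BD.
  by rewrite corner_upd (negPf (jB _ BD)) /= su ?mem_head.
- by move=> z a; apply: eq_bigr => B BD; rewrite corner_upd (negPf (jB _ BD)).
- by move=> z; rewrite normr_prod prodr_ile1 // => B; rewrite normr_ge0 u1.
Qed.

End GowersCauchySchwarz.

Section LowerOrderTests.
Variables (R : realFieldType) (V I : finType).
Hypothesis V_gt0 : (0 < #|V|)%N.
Implicit Types (D B : {set I}) (phi : {ffun I -> V} -> R).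

Definition glue (z0 z1 : {ffun I -> V}) : {ffun I * bool -> V} :=
  [ffun q => if q.2 then z1 q.1 else z0 q.1].

Lemma corner_glue B z0 z1 :
  corner B (glue z0 z1) = [ffun i => if i \in B then z1 i else z0 i].
Proof. by apply/ffunP => i; rewrite !ffunE. Qed.

Lemma avg_glue (h : {ffun I * bool -> V} -> R) :
  avg h = avg (fun z1 => avg (fun z0 => h (glue z0 z1))).
Proof.
rewrite avg_exchange -(avg_pair (fun p => h (glue p.1 p.2))).
symmetry; apply: (avg_bij h (h := fun p => glue p.1 p.2)).
exists (fun z : {ffun I * bool -> V} =>
          ([ffun i => z (i, false)] : {ffun I -> V},
           [ffun i => z (i, true)] : {ffun I -> V})).
  by case=> z0 z1; congr (_, _); apply/ffunP => i; rewrite !ffunE.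
by move=> z; apply/ffunP => -[i []]; rewrite !ffunE.
Qed.

Lemma ffun_gt0 : (0 < #|{ffun I -> V}|)%N.
Proof. by rewrite card_ffun expn_gt0 V_gt0. Qed.

Lemma box_set0 phi : box phi set0 = avg phi.
Proof.
rewrite /box avg_glue avg_exchange; apply: eq_avg => z0.
rewrite -[RHS](avg_const _ ffun_gt0); apply: eq_avg => z1.
rewrite (big_pred1 set0) => [|B]; last by rewrite subset0.
by rewrite corner_glue; congr phi; apply/ffunP => i; rewrite ffunE inE.
Qed.

(** Start from [D] empty, where the box average is the plain average. *)
Lemma gowers_cauchy_schwarz D phi (u : I -> {ffun I -> V} -> R) :
  {in D, forall j, ignores j (u j)} -> (forall j x, `|u j x| <= 1) ->
  avg (fun x => phi x * \prod_(j in D) u j x) ^+ (2 ^ #|D|) <= box phi D.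
Proof.
move=> uD u1.
have -> : avg (fun x => phi x * \prod_(j in D) u j x)
        = avg (fun x => phi x * \prod_(j <- enum D) u j x).
  by apply: eq_avg => x; rewrite big_enum.
rewrite -box_set0 cardE.
have {3}-> : D = set0 :|: [set j in enum D].
  by apply/setP => j; rewrite !inE mem_enum.
apply: gowers_cauchy_schwarz_seq => //; first exact: enum_uniq.
  by move=> j _; rewrite inE.
by move=> j; rewrite mem_enum; apply: uD.
Qed.

(** Gowers-Cauchy-Schwarz with constant tests bounds the box average below by
an even power. *)
Lemma box_ge0 D phi : D != set0 -> 0 <= box phi D.
Proof.
rewrite -card_gt0 => D0.
apply: le_trans (@gowers_cauchy_schwarz D phi (fun _ _ => 1) _ _); first last.
- by move=> _ _; rewrite normr1.
- by [].
by rewrite exprn_even_ge0 // oddX orbF -lt0n D0.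
Qed.

(** Any finite family of tests is reduced to one test per coordinate by
grouping them according to a coordinate that they ignore. *)
Lemma box_bounds_tests D phi (Q : finType) (c : Q -> {ffun I -> V} -> R) :
  (forall q, exists2 j, j \in D & ignores j (c q)) ->
  (forall q x, `|c q x| <= 1) ->
  avg (fun x => phi x * \prod_q c q x) ^+ (2 ^ #|D|) <= box phi D.
Proof.
move=> cD c1.
have [j jP] := choice (fun q => (let: ex_intro2 j jD jq := cD q in
  ex_intro (fun j => j \in D /\ ignores j (c q)) j (conj jD jq))).
pose u i x := \prod_(q | j q == i) c q x.
have -> : avg (fun x => phi x * \prod_q c q x)
        = avg (fun x => phi x * \prod_(i in D) u i x).
  apply: eq_avg => x; congr (_ * _).
  by apply: partition_big => q _; have [] := jP q.
apply: gowers_cauchy_schwarz => [i _ x a|i x].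
  by apply: eq_bigr => q /eqP <-; have [_ ->] := jP q.
by rewrite normr_prod prodr_ile1 // => q; rewrite normr_ge0 c1.
Qed.

End LowerOrderTests.

(** * Deviation as a box average *)
Lemma littleo_powP (R : realType) (f : nat -> R) p :
  (f =o_eventually (fun n : nat => n%:R ^+ p : R)) <->
  (forall eps : R, 0 < eps ->
     exists N, forall n, (N <= n)%N -> `|f n| <= eps * n%:R ^+ p).
Proof.
rewrite eqoP; split=> H eps e0.
  have [N _ HN] := H eps e0; exists N => n Nn.
  by have := HN n Nn; rewrite /= [X in _ <= _ * X]ger0_norm // exprn_ge0.
have [N HN] := H eps e0; exists N => // n Nn /=.
by rewrite [X in _ <= _ * X]ger0_norm ?exprn_ge0 //; apply: HN.
Qed.

Section Signs.
Variables (R : realFieldType) (V : finType) (E : {set {set V}}).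

Definition esign (T : {set V}) : R := (-1) ^+ (T \in E).

Definition isign (I : finType) (z : {ffun I -> V}) : R :=
  esign [set z i | i : I].

Lemma norm_esign T : `|esign T| = 1.
Proof. by rewrite /esign normrX normrN normr1 expr1n. Qed.

Lemma signX_cardI (S : {set {set V}}) :
  (-1) ^+ #|S :&: E| = \prod_(T in S) esign T.
Proof.
rewrite prodrXr -sum1_card; under eq_bigl do rewrite inE.
rewrite big_mkcondr.
by congr (_ ^+ _); apply: eq_bigr => T _; case: (T \in E).
Qed.

End Signs.

Section Octahedra.
Variables (R : realFieldType) (V : finType) (E : {set {set V}}).
Variables (m l : nat).
Hypothesis V_gt0 : (0 < #|V|)%N.
Local Notation I0 := ('I_m + 'I_l)%type.

Definition dev_avg : R :=
  avg (fun x : {ffun 'I_m -> V} => avg (fun y : {ffun 'I_l * bool -> V} =>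
    (-1) ^+ #|squashed_octahedron x y :&: E|)).

Definition apex (z : {ffun I0 * bool -> V}) : {ffun 'I_m -> V} :=
  [ffun i => z (inl i, false)].

Definition wings (z : {ffun I0 * bool -> V}) : {ffun 'I_l * bool -> V} :=
  [ffun q => z (inr q.1, q.2)].

Definition doubled : {set I0} := [set inr j | j : 'I_l].

Lemma avg_apex_wings (g : {ffun 'I_m -> V} -> {ffun 'I_l * bool -> V} -> R) :
  avg (fun x => avg (g x)) = avg (fun z => g (apex z) (wings z)).
Proof.
pose F (q : {ffun 'I_m -> V} * {ffun 'I_m -> V} * {ffun 'I_l * bool -> V}) :=
  g q.1.1 q.2.
pose h (z : {ffun I0 * bool -> V}) := (apex z,
  ([ffun i => z (inl i, true)] : {ffun 'I_m -> V}), wings z).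
transitivity (avg (fun z => F (h z))); last by [].
rewrite (avg_bij F); last first.
  exists (fun q : {ffun 'I_m -> V} * {ffun 'I_m -> V} * {ffun 'I_l * bool -> V} =>
    [ffun i : I0 * bool => match i.1 with
    | inl a => if i.2 then q.1.2 a else q.1.1 a
    | inr j => q.2 (j, i.2) end]).
    by move=> z; apply/ffunP => -[[a|j] []]; rewrite !ffunE /= ?ffunE.
  case=> [[x x'] y]; congr (_, _, _).
  - by apply/ffunP => i; rewrite !ffunE /= ?ffunE.
  - by apply/ffunP => i; rewrite !ffunE /= ?ffunE.
  - by apply/ffunP => -[i b]; rewrite !ffunE /= ?ffunE.
rewrite avg_pair avg_pair; apply: eq_avg => x.
by rewrite -[LHS](avg_const _ (ffun_gt0 'I_m V_gt0)).
Qed.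

Definition chosen (b : {ffun 'I_l -> bool}) : {set I0} :=
  [set i | if i is inr j then b j else false].

Lemma prod_subsets_doubled (F : {set I0} -> R) :
  \prod_(B : {set I0} | B \subset doubled) F B = \prod_b F (chosen b).
Proof.
rewrite (reindex_onto chosen (fun B => [ffun j => inr j \in B])) /=; last first.
  move=> B /subsetP BD; apply/setP => i; rewrite inE.
  case: i => [a|j]; last by rewrite ffunE.
  by apply/esym/negP => /BD /imsetP[].
apply: eq_bigl => b.
have -> : chosen b \subset doubled.
  apply/subsetP => -[a|j]; rewrite inE // => _.
  by apply/imsetP; exists j.
by apply/eqP/ffunP => j; rewrite ffunE inE.
Qed.

Lemma corner_chosen b (z : {ffun I0 * bool -> V}) :
  [set corner (chosen b) z i | i : I0] =
  [set apex z i | i : 'I_m] :|: [set wings z (j, b j) | j : 'I_l].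
Proof.
apply/setP => v; rewrite inE; apply/imsetP/orP.
  case=> -[a|j] _ ->; [left|right]; apply/imsetP.
    by exists a => //; rewrite !ffunE inE.
  by exists j => //; rewrite !ffunE inE.
case=> /imsetP[i _ ->]; [exists (inl i)|exists (inr i)] => //.
  by rewrite !ffunE inE.
by rewrite !ffunE inE.
Qed.

(** For distinct vertices the [2 ^ l] corners are distinct sets, so counting
edges in the set of corners agrees with multiplying signs over corners. *)
Lemma octahedron_sign (z : {ffun I0 * bool -> V}) : injective z ->
  (-1) ^+ #|squashed_octahedron (apex z) (wings z) :&: E| =
  \prod_(B : {set I0} | B \subset doubled) isign R E (corner B z).
Proof.
move=> z_inj; rewrite signX_cardI prod_subsets_doubled big_imset /=; last first.
  move=> b b' _ _ /setP eqbb; apply/ffunP => j; apply/eqP/negPn/negP => bj.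
  have := eqbb (wings z (j, b j)); rewrite !inE.
  rewrite [in X in _ || X](imset_f (fun j => wings z (j, b j))) // orbT.
  move=> /esym/orP[] /imsetP[i _]; rewrite !ffunE /= => /z_inj //.
  by case=> ij; move: bj; rewrite ij => /eqP bj /bj.
by apply: eq_bigr => b _; rewrite /isign corner_chosen.
Qed.

Lemma dev_avg_box :
  `|dev_avg - box (@isign R V E I0) doubled|
  <= 2 * ((2 * (m + l)) ^ 2)%:R / #|V|%:R.
Proof.
rewrite /dev_avg avg_apex_wings -avgB.
apply: le_trans (ler_norm_avg _) _.
apply: le_trans (_ : _ <= avg (fun z : {ffun I0 * bool -> V} => 2 * noninj R z)) _.
  apply: ler_avg => z; rewrite /noninj; case: injectiveP => /= [zi|_].
    by rewrite octahedron_sign // subrr normr0 mulr0.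
  rewrite mulr1; apply: le_trans (ler_normB _ _) _.
  rewrite normrX normrN normr1 expr1n normr_prod.
  by rewrite big1 // => B _; rewrite norm_esign.
rewrite avgZ -mulrA ler_wpM2l //; apply: le_trans (avg_noninj _ _ V_gt0) _.
rewrite card_prod card_sum !card_ord card_bool natrX.
by rewrite (mulnC 2).
Qed.

End Octahedra.

Section Transport.
Variables (R : realFieldType) (V I J : finType) (g : I -> J).
Hypothesis g_bij : bijective g.

Definition pullback (z : {ffun J -> V}) : {ffun I -> V} := [ffun i => z (g i)].

Lemma avg_pullback (h : {ffun I -> V} -> R) :
  avg (fun z => h (pullback z)) = avg h.
Proof.
have [g' gK g'K] := g_bij; apply: avg_bij.
exists (fun z : {ffun I -> V} => [ffun j => z (g' j)]) => z; apply/ffunP => i.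
  by rewrite !ffunE g'K.
by rewrite !ffunE gK.
Qed.

Lemma pullback_ignores T j (h : {ffun I -> V} -> T) :
  ignores j h -> ignores (g j) (fun z => h (pullback z)).
Proof.
move=> hj z a; rewrite -[RHS](hj _ a); congr h.
by apply/ffunP => i; rewrite !ffunE (inj_eq (bij_inj g_bij)).
Qed.

Lemma imset_pullback z : [set pullback z i | i : I] = [set z j | j : J].
Proof.
have [g' gK g'K] := g_bij; apply/setP => v; apply/imsetP/imsetP => -[i _ ->].
  by exists (g i); rewrite ?ffunE.
by exists (g' i); rewrite ?ffunE ?g'K.
Qed.

End Transport.

(** Lets two prescribed coordinates be among the doubled ones. *)
Lemma bij_two_points (I J : finType) (a b : I) (a' b' : J) :
  #|I| = #|J| -> a != b -> a' != b' ->
  exists g : I -> J, [/\ bijective g, g a = a' & g b = b'].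
Proof.
move=> IJ ab a'b'.
pose g0 i := enum_val (cast_ord IJ (enum_rank i)).
have g0i : injective g0.
  by move=> i j /enum_val_inj /cast_ord_inj /enum_rank_inj.
pose g1 i := tperm (g0 a) a' (g0 i).
have g1i : injective g1 by move=> i j /perm_inj /g0i.
have g1a : g1 a = a' by rewrite /g1 tpermL.
exists (fun i => tperm (g1 b) b' (g1 i)); split.
- apply: inj_card_bij; last by rewrite IJ.
  by move=> i j /perm_inj /g1i.
- rewrite tpermD // g1a ?(eq_sym b') // -g1a.
  by apply: contraNneq ab => /g1i ->.
- by rewrite tpermL.
Qed.

(** Two test factors are enough: the factors attached to the other doubled
coordinates are constant, which is why any [l >= 2] works. *)
Lemma dev_bounds_products (R : realFieldType) (V I : finType)
    (E : {set {set V}}) (m l : nat) (a b : I) (w w' : {ffun I -> V} -> R) :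
  (0 < #|V|)%N -> #|I| = (m + l)%N -> (2 <= l)%N -> a != b ->
  ignores b w -> ignores a w' ->
  (forall z, `|w z| <= 1) -> (forall z, `|w' z| <= 1) ->
  avg (fun z => isign R E z * (w z * w' z)) ^+ (2 ^ l)
  <= `|dev_avg R E m l| + 2 * ((2 * (m + l)) ^ 2)%:R / #|V|%:R.
Proof.
move=> V0 cI l2 ab wb w'a w1 w'1.
have l0 : (0 < l)%N by apply: leq_trans l2.
pose J : finType := ('I_m + 'I_l)%type.
pose a' : J := inr (Ordinal l0); pose b' : J := inr (Ordinal l2).
have cIJ : #|I| = #|J| by rewrite cI card_sum !card_ord.
have [g [gb ga gb']] := @bij_two_points I J a b a' b' cIJ ab isT.
rewrite -(avg_pullback gb).
pose c (q : bool) (z : {ffun J -> V}) := (if q then w else w') (pullback g z).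
have -> : avg (fun z : {ffun J -> V} => isign R E (pullback g z) *
             (w (pullback g z) * w' (pullback g z)))
        = avg (fun z => isign R E z * \prod_q c q z).
  by apply: eq_avg => z; rewrite /isign imset_pullback // big_bool.
have -> : (2 ^ l)%N = (2 ^ #|doubled m l|)%N.
  rewrite card_imset; last by move=> i j [].
  by rewrite card_ord.
apply: le_trans
  (@box_bounds_tests R V J V0 (doubled m l) (isign R E (I := J)) bool c _ _) _.
- have Dj j : inr j \in doubled m l by apply/imsetP; exists j.
  case; [exists b'; first exact: Dj|exists a'; first exact: Dj].
    by rewrite -gb'; exact: (pullback_ignores gb wb).
  by rewrite -ga; exact: (pullback_ignores gb w'a).
- by case=> z; rewrite /c.
have := dev_avg_box R E m l V0.
set d := dev_avg _ _ _ _; set B := box _ _; set e := _ / _ => H.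
have := ler_norm d; have := ler_norm (B - d); rewrite distrC.
move: H; move: `|d| `|d - B| => x y; lra.
Qed.

(** * Deviation implies Expand *)
(** The error term is the maximum over the finitely many test objects on n
vertices. *)
Lemma exists_uniform_littleo (R : realType) p (X : nat -> finType)
    (Q : forall n, X n -> R) :
  (forall eps : R, 0 < eps -> exists N, forall n, (N <= n)%N ->
     forall x : X n, `|Q n x| <= eps * n%:R ^+ p) ->
  exists2 err : nat -> R, err =o_eventually (fun n : nat => n%:R ^+ p : R)
    & forall n (x : X n), `|Q n x| <= err n.
Proof.
move=> HQ; exists (fun n => \big[Num.max/0]_(x : X n) `|Q n x|); last first.
  by move=> n x; apply: le_bigmax.
apply/littleo_powP => eps e0; have [N HN] := HQ _ e0; exists N => n Nn.
rewrite ger0_norm ?bigmax_ge_id //; apply: bigmax_le => [|x _].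
  by rewrite mulr_ge0 ?exprn_ge0 // ltW.
exact: HN.
Qed.

Lemma exists_div_le (R : realType) (C eps : R) : 0 < eps ->
  exists N, forall n, (N <= n)%N -> (0 < n)%N /\ C / n%:R <= eps.
Proof.
move=> e0; exists (Num.bound `|C / eps|).+1 => n Nn.
have n0 : (0 < n)%N by apply: leq_trans Nn.
split=> //; rewrite ler_pdivrMr ?ltr0n // mulrC -ler_pdivrMr //.
apply: ltW; apply: (@lt_le_trans _ _ (Num.bound `|C / eps|)%:R).
  exact: le_lt_trans (ler_norm _) (archi_boundP (normr_ge0 _)).
by rewrite ler_nat; apply: ltnW.
Qed.

Lemma ler_norm_root (R : realFieldType) (x e : R) M :
  0 <= e -> ~~ odd M -> (0 < M)%N -> x ^+ M <= e ^+ M -> `|x| <= e.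
Proof.
move=> e0 evM M0 xe; rewrite leNgt; apply/negP => ex.
have : e ^+ M < `|x| ^+ M by rewrite ltr_pXn2r ?nnegrE.
by rewrite -normrX ger0_norm ?exprn_even_ge0 // ltNge xe.
Qed.

Section DeviationAverages.
Variables (R : realType) (k l : nat) (H : hypergraph_seq k).
Hypothesis lk : (l <= k)%N.
Local Notation E n := (edges (hgraph H n)).

Lemma card_vertices_gt0 n : (0 < n)%N -> (0 < #|vertices H n|)%N.
Proof. by rewrite card_vertices. Qed.

Lemma dev_sumE n : (0 < n)%N ->
  \sum_(x : {ffun 'I_(k - l) -> vertices H n})
    \sum_(y : {ffun 'I_l * bool -> vertices H n})
       (-1) ^+ #|squashed_octahedron x y :&: E n| =
  n%:R ^+ (k + l) * dev_avg R (E n) (k - l) l.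
Proof.
move=> n0; rewrite /dev_avg /avg -mulr_sumr !card_ffun card_prod !card_ord.
rewrite card_bool card_vertices [_^-1 * (_^-1 * _)]mulrA -invfM -natrM -expnD.
have -> : (k - l + l * 2 = k + l)%N by lia.
by rewrite natrX mulVKf // expf_neq0 // pnatr_eq0 -lt0n.
Qed.

Lemma Deviation_avgP : Deviation R l H <->
  (forall eps : R, 0 < eps -> exists N, forall n, (N <= n)%N ->
     `|dev_avg R (E n) (k - l) l| <= eps).
Proof.
rewrite /Deviation littleo_powP.
split=> HD eps e0; have [N HN] := HD _ e0; exists N.+1 => n Nn;
  have n0 : (0 < n)%N by [apply: leq_trans Nn|]; have := HN n (ltnW Nn);
  rewrite dev_sumE // (normrM (n%:R ^+ (k + l))) normrX normr_nat.
  by rewrite mulrC ler_pM2r // exprn_gt0 // ltr0n.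
by move=> Hn; rewrite mulrC ler_wpM2r // exprn_ge0.
Qed.

Lemma Deviation_orthogonal_products (I : finType) :
  (2 <= l)%N -> #|I| = k -> Deviation R l H ->
  forall eps : R, 0 < eps -> exists N, forall n, (N <= n)%N ->
  (0 < n)%N /\
  forall (a b : I) (w w' : {ffun I -> vertices H n} -> R),
    a != b -> ignores b w -> ignores a w' ->
    (forall z, `|w z| <= 1) -> (forall z, `|w' z| <= 1) ->
    `|avg (fun z => isign R (E n) z * (w z * w' z))| <= eps.
Proof.
move=> l2 cI /Deviation_avgP HD eps e0.
have d0 : 0 < eps ^+ (2 ^ l) / 2 by rewrite divr_gt0 // exprn_gt0.
have [N1 HN1] := HD _ d0.
have [N2 HN2] := exists_div_le (2 * ((2 * (k - l + l)) ^ 2)%:R) d0.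
exists (maxn N1 N2) => n; rewrite geq_max => /andP[/HN1 H1 /HN2[n0 H2]].
split=> // a b w w' ab wb w'a w1 w'1.
apply: (@ler_norm_root _ _ _ (2 ^ l)); first exact: ltW.
- by rewrite oddX orbF -lt0n (ltnW l2).
- by rewrite expn_gt0.
have cI' : #|I| = (k - l + l)%N by rewrite subnK.
apply: le_trans (dev_bounds_products (E n) (card_vertices_gt0 n0) cI' l2 ab
                   wb w'a w1 w'1) _.
rewrite card_vertices; apply: le_trans (lerD H1 H2) _.
by rewrite -splitr.
Qed.

End DeviationAverages.

Section ExpandEncoding.
Variables (R : realFieldType) (V : finType) (E : {set {set V}}) (v0 : V).
Variables (p : seq nat) (S : 'I_(size p) -> {set {set V}}).
Hypothesis S_sub : forall i, S i \subset ksubsets V (nth 0%N p i).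

(** The coordinates of a tuple that lists the members of t disjointly indexed
sets, the j-th of size [nth 0 p j]; the block of a coordinate is its tag. *)
Definition slot : finType := {j : 'I_(size p) & 'I_(nth 0%N p j)}.

Lemma card_slot : #|slot| = sumn p.
Proof.
rewrite card_tagged sumnE big_map big_enum /= sumnE (big_nth 0%N) big_mkord.
by apply: eq_bigr => j _; rewrite card_ord.
Qed.

(** The block must list its set in the fixed order of [enum], so that each
set is encoded by exactly one tuple and no factorials appear. *)
Definition block_test (j : 'I_(size p)) (z : {ffun slot -> V}) : bool :=
  [exists A : {set V}, (A \in S j) &&
     [forall q : 'I_(nth 0%N p j),
        z (Tagged (fun j : 'I_(size p) => 'I_(nth 0%N p j)) q)
        == nth v0 (enum A) q]].

Lemma block_test_ignores j (i : slot) : tag i != j -> ignores i (block_test j).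
Proof.
move=> ij z a; apply: eq_existsb => A; congr (_ && _).
apply: eq_forallb => q; rewrite updE ifN //.
by apply: contraNneq ij => <-.
Qed.

Definition enumerate (s : {ffun 'I_(size p) -> {set V}}) : {ffun slot -> V} :=
  [ffun i : slot => nth v0 (enum (s (tag i))) (tagged i)].

Lemma imset_nth_enum (A : {set V}) m : #|A| = m ->
  [set nth v0 (enum A) q | q : 'I_m] = A.
Proof.
move=> Am; apply/setP => v; apply/imsetP/idP => [[q _ ->]|vA].
  by rewrite -mem_enum mem_nth // -cardE Am.
have vm : (index v (enum A) < m)%N by rewrite -Am cardE index_mem mem_enum.
by exists (Ordinal vm) => //=; rewrite nth_index // mem_enum.
Qed.

Let choices := [set s : {ffun 'I_(size p) -> {set V}} | [forall j, s j \in S j]].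

Let card_choice s j : s \in choices -> #|s j| = nth 0%N p j.
Proof.
rewrite inE => /forallP/(_ j) sj.
by have := subsetP (S_sub j) _ sj; rewrite inE => /eqP.
Qed.

Lemma enumerate_image s : s \in choices ->
  [set enumerate s i | i : slot] = \bigcup_j s j.
Proof.
move=> sc; apply/setP => v; apply/imsetP/bigcupP => [[i _ ->]|[j _]].
  exists (tag i) => //; rewrite ffunE -mem_enum mem_nth //.
  by rewrite -cardE card_choice.
rewrite -{1}(imset_nth_enum (card_choice j sc)) => /imsetP[q _ ->].
by exists (Tagged (fun j : 'I_(size p) => 'I_(nth 0%N p j)) q); rewrite ?ffunE.
Qed.

Lemma enumerate_inj : {in choices &, injective enumerate}.
Proof.
move=> s s' sc s'c ss'; apply/ffunP => j.
rewrite -(imset_nth_enum (card_choice j sc)) -(imset_nth_enum (card_choice j s'c)).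
apply: eq_imset => q.
have /ffunP/(_ (Tagged (fun j : 'I_(size p) => 'I_(nth 0%N p j)) q)) := ss'.
by rewrite !ffunE.
Qed.

Lemma mem_enumerate z :
  (z \in [set enumerate s | s in choices]) = [forall j, block_test j z].
Proof.
apply/imsetP/forallP => [[s + ->] j|zb].
  rewrite inE => /forallP/(_ j) sj; apply/existsP; exists (s j).
  by rewrite sj; apply/forallP => q; rewrite ffunE.
have [s sP] := choice (fun j => elimT existsP (zb j)).
exists [ffun j => s j].
  by rewrite inE; apply/forallP => j; rewrite ffunE; case/andP: (sP j).
apply/ffunP => -[j q]; rewrite ffunE /= ffunE.
by have /andP[_ /forallP/(_ q)/eqP] := sP j.
Qed.

(** The indicator of an edge is (1 - f) / 2, so the discrepancy is exactly
- 1/2 times a sum of f over encoded families. *)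
Lemma expand_count_avg :
  (expand_count E S)%:R - 2^-1 * \prod_(i < size p) #|S i|%:R =
  - 2^-1 * (#|V|%:R ^+ sumn p *
     avg (fun z : {ffun slot -> V} =>
       isign R E z * \prod_j (block_test j z)%:R)).
Proof.
have -> : \prod_(i < size p) #|S i|%:R = \sum_(s in choices) 1 :> R.
  under eq_bigr do rewrite -sum1_card natr_sum.
  rewrite bigA_distr_big_dep; apply: eq_big => s.
    by rewrite [RHS]inE; apply/familyP/forallP.
  by rewrite big1.
have -> : (expand_count E S)%:R
        = \sum_(s in choices) (\bigcup_i s i \in E)%:R :> R.
  rewrite /expand_count -sum1_card natr_sum.
  under eq_bigl do rewrite inE; rewrite big_mkcondr /=.
  apply: eq_big => s; first by rewrite inE.
  by case: (_ \in E).
rewrite mulr_sumr -sumrB /avg card_ffun card_slot natrX mulVKf; last first.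
  by rewrite expf_neq0 // pnatr_eq0 -lt0n; apply/card_gt0P; exists v0.
have -> : \sum_(z : {ffun slot -> V}) isign R E z * \prod_j (block_test j z)%:R
        = \sum_(z in [set enumerate s | s in choices]) isign R E z.
  rewrite [RHS]big_mkcond; apply: eq_bigr => z _; rewrite mem_enumerate.
  case: forallP => [zb|zb]; first by rewrite big1 ?mulr1 // => j _; rewrite zb.
  have [j zj] : exists j, ~~ block_test j z.
    by apply/existsP; rewrite -negb_forall; apply/forallP.
  by rewrite (bigD1 j) //= (negPf zj) mul0r mulr0.
rewrite big_imset /=; last exact: enumerate_inj.
rewrite mulr_sumr; apply: eq_bigr => s sc.
rewrite /isign enumerate_image // /esign.
by case: (_ \in E); rewrite ?expr1 ?expr0 ?mulr1n ?mulr0n; field.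
Qed.

End ExpandEncoding.

Lemma Expand_from_averages (R : realType) k p (H : hypergraph_seq k) :
  sumn p = k ->
  (forall eps : R, 0 < eps -> exists N, forall n, (N <= n)%N -> (0 < n)%N /\
     forall (v0 : vertices H n) (S : 'I_(size p) -> {set {set vertices H n}}),
     `|avg (fun z => isign R (edges (hgraph H n)) z
                     * \prod_j (block_test v0 S j z)%:R)| <= eps) ->
  Expand R p H.
Proof.
move=> pk HA.
pose Q n (S : {ffun 'I_(size p) -> {set {set vertices H n}}}) : R :=
  if [forall i, S i \subset ksubsets (vertices H n) (nth 0%N p i)]
  then (expand_count (edges (hgraph H n)) S)%:R
       - 2^-1 * \prod_(i < size p) #|S i|%:R else 0.
have [eps e0|err err_o errP] := @exists_uniform_littleo R k _ Q; last first.
  exists err => // n S /forallP Sk.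
  have := errP n (finfun S); rewrite /Q.
  have -> : fun_of_fin (finfun S) = S by apply/funext => i; rewrite ffunE.
  by rewrite Sk.
have [N HN] := HA _ e0; exists N => n /HN[n0 Hn] S.
rewrite /Q; case: ifP => [/forallP Sk|_]; last first.
  by rewrite normr0 mulr_ge0 ?exprn_ge0 // ltW.
have /card_gt0P[v0 _] := card_vertices_gt0 H n0.
rewrite (expand_count_avg R _ v0 Sk) pk card_vertices.
rewrite normrM (normrM (n%:R ^+ k)) normrX normr_nat normrN.
rewrite (@gtr0_norm _ (2^-1)) ?invr_gt0 // mulrCA [eps * _]mulrC.
rewrite ler_wpM2l ?exprn_ge0 //; apply: le_trans (Hn v0 S).
by rewrite ler_piMl // invf_le1 // ler1n.
Qed.

Lemma Deviation_Expand (R : realType) k l p (H : hypergraph_seq k) :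
  (2 <= l <= k)%N -> proper_partition k p -> Deviation R l H -> Expand R p H.
Proof.
move=> /andP[l2 lk] /and3P[t2 /allP p0 /eqP pk] HD.
have s0 : (0 < size p)%N by apply: leq_trans t2.
pose j0 := Ordinal s0; pose j1 := Ordinal t2.
have pj j : (j < size p)%N -> (0 < nth 0%N p j)%N by move=> jp; apply/p0/mem_nth.
pose block (j : 'I_(size p)) := 'I_(nth 0%N p j).
pose a : slot p := Tagged block (Ordinal (pj j0 s0)).
pose b : slot p := Tagged block (Ordinal (pj j1 t2)).
apply: Expand_from_averages => // eps e0.
have [N HN] := Deviation_orthogonal_products lk l2 (etrans (card_slot p) pk) HD e0.
exists N => n /HN [n0 orth]; split=> // v0 S.
rewrite (eq_avg (g := fun z => isign R (edges (hgraph H n)) z *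
  ((block_test v0 S j0 z)%:R * \prod_(j | j != j0) (block_test v0 S j z)%:R)));
  last by move=> z; rewrite (bigD1 j0).
have ab : a != b by apply/eqP => /(congr1 tag).
apply: (orth a b _ _ ab).
- by move=> z v; rewrite block_test_ignores.
- by move=> z v; apply: eq_bigr => j jj0; rewrite block_test_ignores // eq_sym.
- by move=> z; rewrite normr_nat lern1 leq_b1.
- move=> z; rewrite normr_prod prodr_ile1 // => j.
  by rewrite normr_ge0 normr_nat lern1 leq_b1.
Qed.

(** * Clique discrepancy implies Deviation *)
Lemma avg_prod_ffun (R : realFieldType) (V I : finType) (h : V -> I -> R) :
  avg (fun c : {ffun V -> I} => \prod_v h v (c v)) = \prod_v avg (h v).
Proof.
rewrite /avg -bigA_distr_bigA big_split /= prodr_const card_ffun natrX.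
by rewrite exprVn.
Qed.

Lemma avg_eq1 (R : realFieldType) (I : finType) (i : I) :
  avg (fun a => (a == i)%:R : R) = #|I|%:R^-1.
Proof.
rewrite /avg (bigD1 i) //= eqxx big1 ?addr0 ?mulr1 // => a ai.
by rewrite (negPf ai).
Qed.

Section PartiteCliques.
Variables (V I : finType) (k : nat).
Hypotheses (k_ge3 : (3 <= k)%N) (card_I : #|I| = k).
Variable U : I -> {ffun I -> V} -> bool.
Hypothesis U_ignores : forall j, ignores j (U j).
Variable c : {ffun V -> I}.
Implicit Types z : {ffun I -> V}.

Definition colourful (z : {ffun I -> V}) := [forall i, c (z i) == i].

Lemma colourfulP z : reflect (forall i, c (z i) = i) (colourful z).
Proof. exact: 'forall_eqP. Qed.

Lemma colourful_inj z : colourful z -> injective z.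
Proof. by move=> /colourfulP cz i j zij; rewrite -(cz i) zij cz. Qed.

(** The (k-1)-graph attached to a colouring: rainbow (k-1)-sets missing the
colour [j] and satisfying the condition [U j], which is well defined on them
because it ignores the coordinate [j]. *)
Definition facet_edges : {set {set V}} :=
  [set A | [exists z : {ffun I -> V}, [exists j,
     [&& [forall i, (i != j) ==> (c (z i) == i)], U j z
       & A == z @: ~: [set j]]]]].

Lemma facet_edgesP A :
  reflect (exists z j, [/\ forall i, i != j -> c (z i) = i, U j z
                         & A = z @: ~: [set j]])
          (A \in facet_edges).
Proof.
rewrite inE; apply: (iffP existsP) => [[z /existsP[j]]|[z [j [cz uz ->]]]].
  move=> /and3P[/forallP cz uz /eqP->]; exists z, j; split=> // i ij.
  by have := cz i; rewrite ij => /eqP.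
exists z; apply/existsP; exists j; rewrite uz eqxx andbT /=; apply/andP; split=> //.
by apply/forallP => i; apply/implyP => /cz ->.
Qed.

Lemma facet_edges_sub : facet_edges \subset ksubsets V (k - 1).
Proof.
apply/subsetP => A /facet_edgesP[z [j [cz _ ->]]].
rewrite inE card_in_imset; first by rewrite cardsC1 card_I subn1.
by move=> i i'; rewrite !inE => ij i'j zii'; rewrite -(cz i) // zii' cz.
Qed.

Definition facet_graph := Hypergraph facet_edges_sub.

Definition good := [set z : {ffun I -> V} | colourful z && [forall j, U j z]].

Lemma card_colourful_image z : colourful z -> #|[set z i | i : I]| = k.
Proof. by move=> /colourful_inj zi; rewrite card_imset. Qed.

Lemma good_clique z : z \in good ->
  [set z i | i : I] \in cliques k facet_graph.
Proof.
rewrite inE => /andP[cz /forallP Uz].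
rewrite inE inE card_colourful_image // eqxx /=.
apply/forallP => A; apply/implyP; rewrite inE => /andP[/eqP Ak AT].
have [v vT vA] : exists2 v, v \in [set z i | i : I] & v \notin A.
  apply/subsetPn; apply/negP => /subset_leq_card.
  by rewrite card_colourful_image // Ak; lia.
have /imsetP[j _ vj] := vT.
apply/facet_edgesP; exists z, j; split=> // [i _|].
  exact: colourfulP.
apply/eqP; rewrite eqEcard; apply/andP; split.
  apply/subsetP => x xA; have /imsetP[i _ xi] := subsetP AT _ xA.
  rewrite xi imset_f // !inE; apply: contraNneq vA => ij.
  by rewrite vj -ij -xi.
rewrite card_imset; last exact: colourful_inj.
by rewrite cardsC1 card_I Ak subn1.
Qed.

(** Two vertices of the same colour would lie in a common facet of [T], since
[T] has a third vertex; this is where [3 <= k] is used. Hence [T] is rainbow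
and is listed by its colours; its facet missing colour [j] witnesses [U j]. *)
Lemma clique_good T : T \in cliques k facet_graph ->
  exists2 z, z \in good & T = [set z i | i : I].
Proof.
rewrite inE inE => /andP[/eqP Tk /forallP TG].
have Tt t : t \in T -> T :\ t \in facet_edges.
  move=> tT; apply: (implyP (TG _)); rewrite inE subsetDl andbT.
  by have := cardsD1 t T; rewrite tT Tk => ->; rewrite addKn.
have c_inj : {in T &, injective c}.
  move=> t1 t2 t1T t2T c12; apply/eqP/negPn/negP => t12.
  have [t3] : exists t3, t3 \in T :\: [set t1; t2].
    apply/set0Pn; rewrite -card_gt0 cardsD.
    have : (#|T :&: [set t1; t2]| <= 2)%N.
      apply: leq_trans (subset_leq_card (subsetIr _ _)) _.
      by rewrite cards2; case: (_ != _).
    by rewrite Tk; lia.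
  rewrite !inE negb_or => /andP[/andP[t31 t32] t3T].
  have /facet_edgesP[z [j [cz _ TE]]] := Tt _ t3T.
  have : t1 \in T :\ t3 by rewrite !inE t1T eq_sym t31.
  have : t2 \in T :\ t3 by rewrite !inE t2T eq_sym t32.
  rewrite TE => /imsetP[i2 i2j e2] /imsetP[i1 i1j e1].
  move: i1j i2j; rewrite !inE => /cz ci1 /cz ci2.
  by case/eqP: t12; rewrite e1 e2 -ci1 -ci2 -e1 -e2 c12.
have c_surj i : exists2 v, v \in T & c v = i.
  have /imsetP[v vT ->] : i \in c @: T; last by exists v.
  have -> : c @: T = setT; last by rewrite inE.
  by apply/eqP; rewrite eqEcard subsetT cardsT card_in_imset // card_I Tk leqnn.
have [z0 z0P] := choice (fun i => (let: ex_intro2 v vT cv := c_surj i in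
  ex_intro (fun v => v \in T /\ c v = i) v (conj vT cv))).
pose z : {ffun I -> V} := finfun z0.
have zT i : z i \in T by rewrite ffunE; have [] := z0P i.
have cz i : c (z i) = i by rewrite ffunE; have [] := z0P i.
have z_col : colourful z by apply/colourfulP.
have zE : T = [set z i | i : I].
  apply/eqP; rewrite eq_sym eqEcard card_colourful_image // Tk leqnn andbT.
  by apply/subsetP => _ /imsetP[i _ ->].
exists z => //; rewrite inE z_col; apply/forallP => j.
have /facet_edgesP[z' [j' [cz' Uz' TE]]] := Tt _ (zT j).
have z'T i : i != j' -> z' i \in T /\ z' i != z j.
  move=> ij; have : z' i \in T :\ z j by rewrite TE imset_f // !inE.
  by rewrite !inE => /andP[].
have z'z i : i != j' -> z' i = z i.
  by move=> ij; apply: c_inj; rewrite ?zT ?cz ?cz' //; have [] := z'T i ij.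
have jj' : j' = j.
  apply/eqP/negPn/negP => j'j; have jj : j != j' by rewrite eq_sym.
  by have [_] := z'T j jj; rewrite z'z // eqxx.
have -> : z = upd z' j (z j).
  by apply/ffunP => i; rewrite updE; case: eqP => [->//|/eqP ij]; rewrite z'z ?jj'.
by rewrite U_ignores -jj'.
Qed.

Lemma sum_good (R : realFieldType) (E : {set {set V}}) :
  \sum_(z in good) isign R E z = \sum_(T in cliques k facet_graph) esign R E T.
Proof.
have -> : cliques k facet_graph
        = [set [set z i | i : I] | z : {ffun I -> V} in good].
  apply/setP => T; apply/idP/imsetP => [/clique_good[z zg ->]|[z zg ->]].
    by exists z.
  exact: good_clique.
rewrite big_imset // => z z'; rewrite !inE => /andP[/colourfulP cz _].
move=> /andP[/colourfulP cz' _] /setP zz'; apply/ffunP => i.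
have := zz' (z i); rewrite imset_f // => /esym/imsetP[i' _ zi].
by rewrite zi; congr (z' _); rewrite -(cz i) zi cz'.
Qed.

End PartiteCliques.

Lemma sum_esign (R : realFieldType) (V : finType) (E K : {set {set V}}) :
  \sum_(T in K) esign R E T = - 2 * (#|E :&: K|%:R - 2^-1 * #|K|%:R).
Proof.
rewrite -!sum1_card !natr_sum; under [in RHS]eq_bigl do rewrite setIC inE.
rewrite big_mkcondr /= mulr_sumr -sumrB mulr_sumr; apply: eq_bigr => T _.
by rewrite /esign; case: (T \in E); rewrite ?expr1 ?expr0; field.
Qed.

Section CliqueDiscrepancy.
Variables (R : realFieldType) (V I : finType) (k : nat) (E : {set {set V}}).
Hypotheses (V_gt0 : (0 < #|V|)%N) (k_ge3 : (3 <= k)%N) (card_I : #|I| = k).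
Variable err : R.
Hypothesis disc : forall G : hypergraph (k - 1) V,
  `|#|E :&: cliques k G|%:R - 2^-1 * #|cliques k G|%:R| <= err.

(** The colours of distinct vertices are independent and uniform. *)
Lemma avg_colourful (z : {ffun I -> V}) :
  avg (fun c : {ffun V -> I} => (colourful c z)%:R : R) =
  (1 - noninj R z) / k%:R ^+ k.
Proof.
have I0 : (0 < #|I|)%N by rewrite card_I; lia.
rewrite /noninj; case: injectiveP => /= [zi|nzi]; last first.
  rewrite subrr mul0r (eq_avg (g := fun=> 0)) ?avg_const ?card_ffun ?expn_gt0 ?I0 //.
  by move=> c; case: (boolP (colourful c z)) => // /colourful_inj.
rewrite subr0 mul1r.
(* A colouring is rainbow on z exactly when each vertex v gets a colour
   compatible with its position in z, if it has one. *)
pose h v i : R := [forall j, (z j == v) ==> (j == i)]%:R.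
rewrite (eq_avg (g := fun c : {ffun V -> I} => \prod_v h v (c v))); last first.
  move=> c; case: colourfulP => [cz|ncz].
    rewrite big1 // => v _; rewrite /h; case: forallP => // H; case: H => j.
    by apply/implyP => /eqP <-; rewrite cz.
  have [j jz] : exists j, c (z j) != j.
    apply/existsP; rewrite -negb_forall; apply/negP => /forallP H.
    by apply: ncz => j; apply/eqP/H.
  rewrite (bigD1 (z j)) //= /h; case: forallP => [/(_ j)|_]; rewrite ?mul0r //.
  by rewrite eqxx eq_sym (negPf jz).
rewrite avg_prod_ffun (bigID [in [set z i | i : I]]) /=.
rewrite [X in _ * X]big1 ?mulr1; last first.
  move=> v vz; rewrite (eq_avg (g := fun=> 1)) ?avg_const // => i.
  rewrite /h; case: forallP => // H; case: H => j; apply/implyP => /eqP zj.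
  by rewrite -zj imset_f in vz.
rewrite big_imset /=; last by move=> i j _ _; apply: zi.
rewrite (eq_bigr (fun _ => k%:R^-1)); last first.
  move=> i _; rewrite -card_I -(avg_eq1 R i); apply: eq_avg => a.
  rewrite /h; congr (nat_of_bool _)%:R; apply/forallP/eqP => [/(_ i)|-> j].
    by rewrite eqxx => /eqP.
  by apply/implyP => /eqP /zi ->.
by rewrite prodr_const card_I exprVn.
Qed.

(** Average the clique discrepancy over all colourings. *)
Lemma disc_partite (U : I -> {ffun I -> V} -> bool) :
  (forall j, ignores j (U j)) ->
  `|avg (fun z => isign R E z * [forall j, U j z]%:R)|
  <= k%:R ^+ k * (2 * err / #|V|%:R ^+ k) + avg (@noninj R V I).
Proof.
move=> U_ignores.
pose f z := isign R E z * [forall j, U j z]%:R.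
have f1 z : `|f z| <= 1.
  by rewrite normrM norm_esign mul1r normr_nat lern1 leq_b1.
have kk : 0 < k%:R ^+ k :> R by rewrite exprn_gt0 // ltr0n; lia.
have -> : avg f = avg (fun z => f z * (1 - noninj R z))
               + avg (fun z => f z * noninj R z).
  by rewrite -avgD; apply: eq_avg => z; ring.
apply: le_trans (ler_normD _ _) _; apply: lerD; last first.
  apply: le_trans (ler_norm_avg _) _; apply: ler_avg => z.
  by rewrite normrM /noninj normr_nat ler_piMl.
have -> : avg (fun z => f z * (1 - noninj R z))
        = k%:R ^+ k * avg (fun c : {ffun V -> I} =>
            avg (fun z => f z * (colourful c z)%:R)).
  rewrite avg_exchange -avgZ; apply: eq_avg => z.
  by rewrite avgZ avg_colourful mulrCA [k%:R ^+ k * _]mulrC divfK // gt_eqF.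
rewrite normrM (gtr0_norm kk) ler_wpM2l ?(ltW kk) //.
apply: le_trans (ler_norm_avg _) _.
rewrite -[leRHS](avg_const _ (_ : (0 < #|{ffun V -> I}|)%N)); last first.
  by rewrite card_ffun expn_gt0 card_I; lia.
apply: ler_avg => c; rewrite /avg normrM card_ffun card_I natrX.
rewrite ger0_norm ?invr_ge0 ?exprn_ge0 // mulrC ler_wpM2r ?invr_ge0 ?exprn_ge0 //.
have -> : \sum_z f z * (colourful c z)%:R = \sum_(z in good U c) isign R E z.
  rewrite [RHS]big_mkcond; apply: eq_bigr => z _; rewrite inE /f.
  by case: [forall j, U j z]; case: (colourful c z); rewrite ?mulr1 ?mulr0 ?mul0r.
rewrite (sum_good k_ge3 card_I U_ignores) sum_esign normrM normrN.
by rewrite normr_nat ler_wpM2l // disc.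
Qed.

(** Fix the second values [z1]; the corner at the empty set is the variable
tuple, and the sign of the corner at [B] ignores each coordinate of [B]. The
sum runs over the possible edge patterns [s] of the nonempty corners. *)
Lemma disc_box :
  `|box (@isign R V E I) setT|
  <= (2 ^ (2 ^ k))%:R *
     (k%:R ^+ k * (2 * err / #|V|%:R ^+ k) + avg (@noninj R V I)).
Proof.
rewrite /box avg_glue //; apply: le_trans (ler_norm_avg _) _.
rewrite -[leRHS](avg_const _ (ffun_gt0 I V_gt0)); apply: ler_avg => z1.
set bound := _ + _.
(* The empty set indexes the variable corner itself, which is not part of the
   pattern; setting it to false there keeps the patterns disjoint. *)
pose pat (z0 : {ffun I -> V}) : {ffun {set I} -> bool} :=
  [ffun B => (B != set0) && ([set corner B (glue z0 z1) i | i : I] \in E)].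
pose sgn (s : {ffun {set I} -> bool}) : R := \prod_B (-1) ^+ (s B).
rewrite (eq_avg (g := fun z0 => \sum_(s : {ffun {set I} -> bool})
    if ~~ s set0 then sgn s * (isign R E z0 * (pat z0 == s)%:R) else 0)); last first.
  move=> z0; rewrite -big_mkcond (bigD1 (pat z0)) /=; last by rewrite ffunE eqxx.
  rewrite eqxx mulr1 [X in _ + X]big1 ?addr0; last first.
    move=> s; rewrite andbC eq_sym => /andP[/negPf -> _].
    by rewrite !mulr0.
  rewrite /sgn (bigD1 set0) ?sub0set //= [in RHS](bigD1 set0) //= ffunE eqxx mul1r.
  rewrite mulrC; congr (_ * _).
    apply: eq_big => B; first by rewrite subsetT.
    by move=> /andP[_ B0]; rewrite ffunE B0.
  by congr isign; rewrite corner_glue; apply/ffunP => i; rewrite ffunE inE.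
rewrite avg_sum; apply: le_trans (ler_norm_sum _ _ _) _.
have -> : (2 ^ 2 ^ k)%:R * bound
        = \sum_(s : {ffun {set I} -> bool}) bound.
  rewrite sumr_const mulr_natl card_ffun card_bool.
  have -> : #|{set I}| = (2 ^ k)%N.
    by rewrite -(cardsT {set I}) -(powersetT I) card_powerset cardsT card_I.
  by [].
have bound0 : 0 <= bound.
  by apply: le_trans (normr_ge0 _) (disc_partite (U := fun _ _ => true) _).
apply: ler_sum => s _; case s0: (s set0) => /=.
  by rewrite /avg big1 ?mulr0 ?normr0.
rewrite avgZ normrM.
have -> : `|sgn s| = 1.
  by rewrite normr_prod big1 // => B _; rewrite normrX normrN normr1 expr1n.
rewrite mul1r.
pose U j z0 := [forall B : {set I}, (j \in B) ==> (pat z0 B == s B)].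
have U_ignores j : ignores j (U j).
  move=> z0 a; apply: eq_forallb => B; case jB: (j \in B) => //=; rewrite !ffunE.
  have -> // : corner B (glue (upd z0 j a) z1) = corner B (glue z0 z1).
  rewrite !corner_glue; apply/ffunP => i; rewrite !ffunE.
  by case: (eqVneq i j) => // ->; rewrite jB.
apply: le_trans (disc_partite U_ignores).
rewrite le_eqVlt; apply/orP; left; apply/eqP; congr `|_|.
apply: eq_avg => z0; congr (_ * (nat_of_bool _)%:R).
apply/eqP/forallP => [ps j|HU].
  by apply/forallP => B; rewrite ps eqxx implybT.
apply/ffunP => B; case: (set_0Vmem B) => [->|[j jB]].
  by rewrite ffunE eqxx s0.
by have /forallP/(_ B) := HU j; rewrite jB => /eqP.
Qed.

End CliqueDiscrepancy.

Lemma CliqueDisc_Deviation (R : realType) k (H : hypergraph_seq k) :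
  (3 <= k)%N -> CliqueDisc R (k - 1) H -> Deviation R k H.
Proof.
move=> k3 [err err_o disc]; apply/Deviation_avgP => // eps e0.
pose I : finType := ('I_(k - k) + 'I_k)%type.
have cI : #|I| = k by rewrite card_sum !card_ord; lia.
pose M : R := (2 ^ (2 ^ k))%:R.
have M0 : 0 < M by rewrite ltr0n expn_gt0.
pose K : R := k%:R ^+ k * 2.
have K0 : 0 < K by rewrite mulr_gt0 // exprn_gt0 // ltr0n; lia.
have [N1 HN1] := (littleo_powP err k).1 err_o (eps / 2 / M / K)
   (divr_gt0 (divr_gt0 (divr_gt0 e0 (ltr0n _ 2)) M0) K0).
have [N2 HN2] := exists_div_le (M * k%:R ^+ 2 + 2 * ((2 * (k - k + k)) ^ 2)%:R)
   (divr_gt0 e0 (ltr0n R 2)).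
exists (maxn N1 N2) => n; rewrite geq_max => /andP[/HN1 H1 /HN2[n0 H2]].
have V0 := card_vertices_gt0 H n0.
have nk : 0 < n%:R ^+ k :> R by rewrite exprn_gt0 // ltr0n.
have := dev_avg_box R (edges (hgraph H n)) (k - k) k V0.
have -> : doubled (k - k) k = setT.
  apply/setP => -[[i ik]|j]; first by exfalso; move: ik; rewrite subnn.
  rewrite [RHS]inE.
  by apply/imsetP; exists j.
have := disc_box V0 k3 cI (disc n).
have := avg_noninj R I V0.
rewrite -/M card_vertices cI.
set x := avg _; set b := box _ _; set d := dev_avg _ _ _ _.
move=> Hx Hb Hd.
have He : k%:R ^+ k * (2 * err n / n%:R ^+ k) <= eps / 2 / M.
  rewrite mulrA mulrA -/K ler_pdivrMr // mulrC -ler_pdivlMr //.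
  apply: le_trans (ler_norm _) _; apply: le_trans H1 _.
  by rewrite mulrAC.
have {}Hb : `|b| <= eps / 2 + M * k%:R ^+ 2 / n%:R.
  apply: le_trans Hb _.
  apply: le_trans (ler_wpM2l (ltW M0) (lerD He Hx)) _.
  by rewrite mulrDr [M * (eps / 2 / M)]mulrC divfK ?gt_eqF // mulrA.
have := ler_normD (d - b) b; rewrite subrK.
move: H2; rewrite mulrDl.
move: Hb Hd; move: `|b| `|d - b| `|d| (_ / n%:R) (_ / n%:R) => *; lra.
Qed.

(** * Random signs on facets *)
Section RandomSigns.
Variables (R : realFieldType) (V I : finType).
Hypothesis V_gt0 : (0 < #|V|)%N.
Implicit Types (rho : {ffun {set V} -> bool}) (T : {set V}).

Definition face_sign rho T : R := (-1) ^+ (rho T).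

Lemma norm_face_sign rho T : `|face_sign rho T| = 1.
Proof. by rewrite /face_sign normrX normrN normr1 expr1n. Qed.

Definition flip (T0 : {set V}) rho : {ffun {set V} -> bool} :=
  [ffun T => rho T (+) (T == T0)].

Lemma flipK T0 : involutive (flip T0).
Proof. by move=> rho; apply/ffunP => T; rewrite !ffunE addbK. Qed.

(** Flipping the sign of the image of the corner at the empty set changes the
sign of the product, because the other corners have a different image. *)
Lemma avg_corner_signs (D : {set I}) (z : {ffun I * bool -> V}) :
  D != set0 -> injective z ->
  avg (fun rho => \prod_(B : {set I} | B \subset D)
                    face_sign rho (corner B z @: D)) = 0.
Proof.
move=> D0 zi; set F := fun rho => _.
pose T0 := corner set0 z @: D.
have FN rho : F (flip T0 rho) = - F rho.
  rewrite /F (bigD1 set0) ?sub0set //= [in RHS](bigD1 set0) ?sub0set //=.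
  rewrite -mulNr; congr (_ * _).
    by rewrite /face_sign ffunE eqxx addbT signrN.
  apply: eq_bigr => B /andP[BD /set0Pn[j jB]].
  rewrite /face_sign ffunE; suff /negPf -> : corner B z @: D != T0 by rewrite addbF.
  apply/negP => /eqP/setP/(_ (corner B z j)).
  rewrite imset_f ?(subsetP BD) // => /esym/imsetP[i _].
  by rewrite !ffunE jB inE => /zi [].
have : avg F = - avg F.
  rewrite -{1}(avg_bij F (inv_bij (flipK T0))) (eq_avg FN).
  by rewrite -mulN1r -avgZ; apply: eq_avg => rho; rewrite mulN1r.
by move: (avg F) => x; lra.
Qed.

Lemma avg_box_signs (D : {set I}) : D != set0 ->
  avg (fun rho => box (fun z => face_sign rho (z @: D)) D)
  <= avg (@noninj R V (I * bool)%type).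
Proof.
move=> D0; rewrite /box avg_exchange; apply: ler_avg => z; rewrite /noninj.
case: injectiveP => /= [zi|_]; first by rewrite avg_corner_signs.
apply: le_trans (ler_norm _) _; apply: le_trans (ler_norm_avg _) _.
rewrite -[leRHS](avg_const (T := {ffun {set V} -> bool})); last first.
  by rewrite card_ffun expn_gt0 card_bool.
apply: ler_avg => rho; rewrite normr_prod big1 // => B _.
by rewrite norm_face_sign.
Qed.

(** The average over [rho] of the sum of the box averages is small and each of
them is nonnegative, so some [rho] works for all facets simultaneously. *)
Lemma exists_quasirandom_signs : (2 <= #|I|)%N ->
  exists rho, forall i : I,
    box (fun z => face_sign rho (z @: ~: [set i])) (~: [set i])
    <= (#|I| * (2 * #|I|) ^ 2)%:R / #|V|%:R.
Proof.
move=> I2; pose D i : {set I} := ~: [set i].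
have D0 i : D i != set0.
  by rewrite -card_gt0 cardsC1; lia.
pose b i rho := box (fun z => face_sign rho (z @: D i)) (D i).
have [|rho Hrho] := @exists_le_avg R _ (fun rho => \sum_i b i rho).
  by rewrite card_ffun expn_gt0 card_bool.
exists rho => i; apply: le_trans (_ : _ <= \sum_i b i rho) _.
  rewrite (bigD1 i) //= lerDl sumr_ge0 // => j _.
  exact: box_ge0.
apply: le_trans Hrho _; rewrite avg_sum natrM -mulrA mulr_natl -sumr_const.
apply: ler_sum => j _; apply: le_trans (avg_box_signs (D0 j)) _.
apply: le_trans (avg_noninj _ _ V_gt0) _.
by rewrite card_prod card_bool natrX mulnC.
Qed.

End RandomSigns.

(** * A hypergraph defeating lower-order tests without deviation *)
Section Construction.
Variables (R : realFieldType) (V I : finType) (k : nat).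
Hypotheses (V_gt0 : (0 < #|V|)%N) (k_ge3 : (3 <= k)%N) (card_I : #|I| = k).
Variables (side : {set V}) (rho : {ffun {set V} -> bool}).
Implicit Types (z : {ffun I -> V}) (t : {set I}).

(** Exactly two removable vertices make the sign of [T] split into a factor
for each of them, which spoils deviation; at least two are always kept, so
that no test of lower order can see the sign. *)
Definition removable (T : {set V}) : {set V} :=
  if #|T :&: side| == 2 then T :&: side else T.

Definition facet_parity_edges : {set {set V}} :=
  [set T in ksubsets V k | odd (\sum_(v in removable T) rho (T :\ v))].

Lemma facet_parity_sub : facet_parity_edges \subset ksubsets V k.
Proof. by apply/subsetP => T; rewrite inE => /andP[]. Qed.

Local Notation E := facet_parity_edges.
Local Notation sgn := (face_sign R rho).

Definition trace z : {set I} := [set i | z i \in side].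
Definition dropped t : {set I} := if #|t| == 2 then t else setT.
Definition facet_sign z (i : I) : R := sgn (z @: ~: [set i]).

Lemma isign_injective z : injective z ->
  isign R E z = \prod_(i in dropped (trace z)) facet_sign z i.
Proof.
move=> zi; rewrite /isign /esign inE inE card_imset // card_I eqxx /=.
rewrite signr_odd -prodrXr.
have -> : removable [set z i | i : I] = z @: dropped (trace z).
  have traceE : [set z i | i : I] :&: side = z @: trace z.
    apply/setP => v; rewrite inE; apply/andP/imsetP => [[/imsetP[i _ ->] vs]|].
      by exists i; rewrite ?inE.
    by case=> i; rewrite inE => zs ->; rewrite imset_f.
  rewrite /removable /dropped traceE card_imset //; case: ifP => // _.
  by apply/setP => v; apply/imsetP/imsetP => -[i _ ->]; exists i.
rewrite big_imset /=; last by move=> i j _ _; apply: zi.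
apply: eq_bigr => i _; congr ((-1) ^+ (rho _)).
apply/setP => v; rewrite !inE; apply/andP/imsetP => [[vi /imsetP[j _ vj]]|[j]].
  by exists j; rewrite ?inE //; apply: contraNneq vi => <-; rewrite vj.
by rewrite !inE => ji ->; rewrite imset_f // (inj_eq zi).
Qed.

Lemma avg_isign_injective (w : {ffun I -> V} -> R) :
  (forall z, `|w z| <= 1) ->
  `|avg (fun z => isign R E z * w z)
    - avg (fun z => \prod_(i in dropped (trace z)) facet_sign z i * w z)|
  <= 2 * avg (@noninj R V I).
Proof.
move=> w1; rewrite -avgB; apply: le_trans (ler_norm_avg _) _; rewrite -avgZ.
apply: ler_avg => z; rewrite /noninj; case: injectiveP => /= [zi|_].
  by rewrite isign_injective // subrr normr0 mulr0.
rewrite mulr1 -mulrBl normrM -[2]mulr1; apply: ler_pM => //.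
apply: le_trans (ler_normB _ _) _; rewrite norm_esign normr_prod big1 // => i _.
exact: norm_face_sign.
Qed.

Lemma facet_sign_ignores i : ignores i (facet_sign^~ i).
Proof.
move=> z a; congr sgn; apply: eq_in_imset => j; rewrite !inE updE.
by move=> /negPf ->.
Qed.

(** As [#|I| = k >= 3]; the two coordinates may coincide. *)
Lemma exists_third (i j : I) : exists2 q, q != i & q != j.
Proof.
have [q] : exists q, q \in ~: [set i; j].
  apply/set0Pn; rewrite -card_gt0; have := cardsC [set i; j].
  by rewrite card_I cards2; case: (i != j); move: #|~: _| => c; lia.
by rewrite !inE negb_or => /andP[]; exists q.
Qed.

(** Sort tuples by the coordinates [t] lying in [side]. Once [i] is chosen
among the dropped coordinates so that every test ignores some coordinate other
than [i], the sign of the facet opposite to [i] is multiplied only by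
functions ignoring one of its own coordinates: tests, side conditions on single
coordinates, and signs of other facets. *)
Lemma tests_bound (beta : R) (Q : finType) (c : Q -> {ffun I -> V} -> R) :
  0 <= beta ->
  (forall i, box (facet_sign^~ i) (~: [set i]) <= beta ^+ (2 ^ (k - 1))) ->
  (forall q z, `|c q z| <= 1) ->
  (forall i0 i1, i0 != i1 -> exists2 i, i \in [set i0; i1] &
     forall q, exists2 j, j != i & ignores j (c q)) ->
  `|avg (fun z => isign R E z * \prod_q c q z)|
  <= 2 * avg (@noninj R V I) + (2 ^ k)%:R * beta.
Proof.
move=> beta0 boxb c1 c_ignores.
pose C z := \prod_q c q z.
have C1 z : `|C z| <= 1.
  by rewrite normr_prod prodr_ile1 // => q; rewrite normr_ge0 c1.
have := avg_isign_injective C1.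
set A := avg _; set A' := avg _ => AA'.
suff HA' : `|A'| <= (2 ^ k)%:R * beta.
  by have := ler_normD (A - A') A'; rewrite subrK => /le_trans; apply; apply: lerD.
have -> : A' = \sum_(t : {set I}) avg (fun z => (trace z == t)%:R *
                 (\prod_(i in dropped t) facet_sign z i * C z)).
  rewrite -avg_sum; apply: eq_avg => z.
  rewrite (bigD1 (trace z)) //= eqxx mul1r [X in _ + X]big1 ?addr0 // => t.
  by rewrite eq_sym => /negPf ->; rewrite mul0r.
apply: le_trans (ler_norm_sum _ _ _) _.
have -> : (2 ^ k)%:R * beta = \sum_(t : {set I}) beta.
  rewrite sumr_const mulr_natl; congr (_ *+ _).
  by rewrite -(cardsT {set I}) -(powersetT I) card_powerset cardsT card_I.
apply: ler_sum => t _.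
have : (1 < #|dropped t|)%N.
  by rewrite /dropped; case: eqP => [->|_] //; rewrite cardsT card_I; lia.
move=> /card_gt1P[i0 [i1 [i0J i1J i01]]].
have [i ii c_i] := c_ignores _ _ i01.
have iJ : i \in dropped t by move: ii; rewrite !inE => /orP[]/eqP->.
pose c' (q : (Q + I + I)%type) z : R := match q with
  | inl (inl q) => c q z
  | inl (inr j) => ((z j \in side) == (j \in t))%:R
  | inr j => if (j \in dropped t) && (j != i) then facet_sign z j else 1 end.
rewrite (eq_avg (g := fun z => facet_sign z i * \prod_q c' q z)); last first.
  move=> z; rewrite !big_sumType /= (bigD1 i) //=.
  have -> : (trace z == t)%:R = \prod_j ((z j \in side) == (j \in t))%:R :> R.
    case: eqP => [<-|tz]; first by rewrite big1 // => j _; rewrite inE eqxx.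
    have [j zj] : exists j, (z j \in side) != (j \in t).
      apply/existsP; rewrite -negb_forall; apply/negP => /forallP H.
      by apply: tz; apply/setP => j; rewrite inE; apply/eqP.
    by rewrite (bigD1 j) //= (negPf zj) mul0r.
  by rewrite -big_mkcond /= /C; ring.
apply: (@ler_norm_root _ _ _ (2 ^ (k - 1))) => //.
- by rewrite oddX orbF; lia.
- by rewrite expn_gt0.
apply: le_trans (boxb i).
have -> : (k - 1)%N = #|~: [set i]| by rewrite cardsC1 card_I subn1.
apply: box_bounds_tests => //.
- case=> [[q|j]|j].
  + by have [q' q'i q'c] := c_i q; exists q' => //; rewrite !inE.
  + have [q qi qj] := exists_third i j; exists q; first by rewrite !inE.
    by move=> z a; rewrite /c' updE [j == q]eq_sym (negPf qj).
  + have [->|ji] := eqVneq j i.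
      have [q qi _] := exists_third i i; exists q; first by rewrite !inE.
      by move=> z a; rewrite /c' eqxx andbF.
    exists j; first by rewrite !inE.
    by move=> z a; rewrite /c'; case: ifP => // _; apply: facet_sign_ignores.
- case=> [[q|j]|j] z; rewrite /c' //.
    by rewrite normr_nat lern1 leq_b1.
  by case: ifP => _; rewrite ?normr1 // norm_face_sign.
Qed.

(** On tuples whose coordinates in [side] are exactly [a] and [b], the sign is
the product of the signs of the two facets opposite to [a] and [b]; using
these same facet signs as tests turns every such term into 1. *)
Lemma correlated_products (a b : I) : a != b ->
  exists w w' : {ffun I -> V} -> R,
    [/\ ignores b w, ignores a w', forall z, `|w z| <= 1, forall z, `|w' z| <= 1 &
     (#|~: side|%:R / #|V|%:R) ^+ (k - 2) * (#|side|%:R / #|V|%:R) ^+ 2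
       - 2 * avg (@noninj R V I)
     <= `|avg (fun z => isign R E z * (w z * w' z))|].
Proof.
move=> ab; pose t := [set a; b].
pose ty (j : I) z : R := ((z j \in side) == (j \in t))%:R.
pose w z := facet_sign z b * \prod_(j | j != b) ty j z.
pose w' z := facet_sign z a * ty b z.
have ty1 j z : `|ty j z| <= 1 by rewrite normr_nat lern1 leq_b1.
have w1 z : `|w z| <= 1.
  rewrite normrM norm_face_sign mul1r normr_prod prodr_ile1 // => j.
  by rewrite normr_ge0 ty1.
have w'1 z : `|w' z| <= 1 by rewrite normrM norm_face_sign mul1r.
exists w, w'; split=> //.
- move=> z v; rewrite /w facet_sign_ignores; congr (_ * _).
  by apply: eq_bigr => j jb; rewrite /ty updE (negPf jb).
- move=> z v; rewrite /w' facet_sign_ignores; congr (_ * _).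
  by rewrite /ty updE [b == a]eq_sym (negPf ab).
have ww'1 z : `|w z * w' z| <= 1 by rewrite normrM mulr_ile1.
have := avg_isign_injective ww'1.
set A := avg _; set A' := avg _ => AA'.
have -> : (#|~: side|%:R / #|V|%:R) ^+ (k - 2) * (#|side|%:R / #|V|%:R) ^+ 2 = A'.
  have -> : A' = avg (fun z => \prod_j ty j z).
    apply: eq_avg => z; have [tz|tz] := eqVneq (trace z) t.
      rewrite tz /dropped cards2 ab /= big_setU1 ?inE // big_set1.
      have sq i : facet_sign z i * facet_sign z i = 1.
        by rewrite /facet_sign /face_sign -expr2 sqrr_sign.
      rewrite (bigD1 b) //= /w /w'.
      transitivity ((facet_sign z a * facet_sign z a) * (facet_sign z b * facet_sign z b)
        * (ty b z * \prod_(j | j != b) ty j z)); first by ring.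
      by rewrite !sq !mul1r.
    have [j zj] : exists j, ty j z = 0.
      have [j zj] : exists j, (z j \in side) != (j \in t).
        apply/existsP; rewrite -negb_forall; apply: contra tz => /forallP H.
        by apply/eqP/setP => j; rewrite inE; apply/eqP.
      by exists j; rewrite /ty (negPf zj).
    have -> : \prod_j ty j z = 0 by rewrite (bigD1 j) //= zj mul0r.
    have -> : w z * w' z = 0; last by rewrite mulr0.
    rewrite /w /w'; have [jb|jb] := eqVneq j b.
      by rewrite -jb zj !mulr0.
    by rewrite (bigD1 j) //= zj mul0r mulr0 mul0r.
  rewrite (avg_prod_ffun (fun j v => ((v \in side) == (j \in t))%:R)).
  have avg_mem (X : {set V}) : avg (fun v => (v \in X)%:R) = #|X|%:R / #|V|%:R :> R.
    rewrite /avg mulrC; congr (_ / _); rewrite -sum1_card natr_sum [RHS]big_mkcond.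
    by apply: eq_bigr => v _; case: (v \in X).
  rewrite (bigID [in t]) /= [RHS]mulrC; congr (_ * _).
    rewrite (eq_bigr (fun=> #|~: side|%:R / #|V|%:R)); last first.
      move=> j jt; rewrite -avg_mem; apply: eq_avg => v.
      by rewrite (negPf jt) inE; case: (v \in side).
    rewrite prodr_const; congr (_ ^+ _).
    have <- : #|~: t| = (k - 2)%N.
      by have := cardsC t; rewrite card_I cards2 ab; move: #|~: t| => x; lia.
    by apply: eq_card => j; rewrite in_setC.
  rewrite (eq_bigr (fun=> #|side|%:R / #|V|%:R)); last first.
    move=> j jt; rewrite -avg_mem; apply: eq_avg => v.
    by rewrite jt; case: (v \in side).
  by rewrite prodr_const cards2 ab.
have := ler_norm A'; have := ler_normD (A' - A) A; rewrite subrK distrC.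
move: AA'; move: `|A| `|A'| `|A - A'| => *; lra.
Qed.

End Construction.

Lemma exists_half_set (V : finType) :
  exists S : {set V}, #|S| = #|V|./2.
Proof.
have h : (#|V|./2 <= #|V|)%N by rewrite -{2}(odd_double_half #|V|); lia.
exists [set enum_val (widen_ord h i) | i : 'I_(#|V|./2)].
rewrite card_imset ?card_ord // => i j /enum_val_inj/(congr1 val) /= ij.
exact: val_inj.
Qed.

Section Counterexample.
Variables (R : realType) (k : nat) (I : finType).
Hypotheses (k_ge3 : (3 <= k)%N) (card_I : #|I| = k).

Definition facet_parity_graph (V : finType) (side : {set V})
    (rho : {ffun {set V} -> bool}) :=
  Hypergraph (facet_parity_sub k side rho).

(** The index type [I] is a parameter because each of Expand and CliqueDisc is
tested with its own type of coordinates. *)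
Lemma exists_facet_parity_sequence : exists H : hypergraph_seq k,
  (forall eps : R, 0 < eps -> exists N, forall n, (N <= n)%N -> (0 < n)%N /\
     forall (Q : finType) (c : Q -> {ffun I -> vertices H n} -> R),
     (forall q z, `|c q z| <= 1) ->
     (forall i0 i1, i0 != i1 -> exists2 i, i \in [set i0; i1] &
        forall q, exists2 j, j != i & ignores j (c q)) ->
     `|avg (fun z => isign R (edges (hgraph H n)) z * \prod_q c q z)| <= eps)
  /\ (forall l, (2 <= l <= k)%N -> ~ Deviation R l H).
Proof.
have ex n : exists sr : {set 'I_n} * {ffun {set 'I_n} -> bool},
    #|sr.1| = n./2 /\ ((0 < n)%N -> forall i : I,
      box (fun z : {ffun I -> 'I_n} => face_sign R sr.2 (z @: ~: [set i]))
        (~: [set i])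
      <= (#|I| * (2 * #|I|) ^ 2)%:R / n%:R).
  have [S S2] := exists_half_set 'I_n; rewrite card_ord in S2.
  have [->|n0] := posnP n.
    by exists (set0, [ffun=> false]); rewrite cards0.
  have [||rho Hrho] := @exists_quasirandom_signs R 'I_n I.
  - by rewrite card_ord.
  - by rewrite card_I; lia.
  by exists (S, rho); split=> // _ i; rewrite -[X in _ / X%:R]card_ord.
pose sr n := sval (cid (ex n)); have srP n := svalP (cid (ex n)).
pose H := HypergraphSeq card_ord (fun n => facet_parity_graph (sr n).1 (sr n).2).
exists H; split=> [eps e0|l l2k].
  pose beta := eps / 2 / (2 ^ k)%:R.
  have M0 : 0 < (2 ^ k)%:R :> R by rewrite ltr0n expn_gt0.
  have beta0 : 0 < beta by rewrite !divr_gt0.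
  have [N1 HN1] := exists_div_le (#|I| * (2 * #|I|) ^ 2)%:R (exprn_gt0 (2 ^ (k - 1)) beta0).
  have [N2 HN2] := exists_div_le (2 * #|I|%:R ^+ 2) (divr_gt0 e0 (ltr0n R 2)).
  exists (maxn N1 N2) => n; rewrite geq_max => /andP[/HN1[n0 H1] /HN2[_ H2]].
  split=> // Q c c1 c_ignores.
  have V0 : (0 < #|'I_n|)%N by rewrite card_ord.
  apply: le_trans (@tests_bound R 'I_n I k V0 k_ge3 card_I (sr n).1 (sr n).2
    beta Q c (ltW beta0) _ c1 c_ignores) _.
    by move=> i; apply: le_trans H1; apply: (srP n).2.
  have := avg_noninj R I V0; rewrite card_ord => Hn.
  rewrite /beta [(2 ^ k)%:R * _]mulrC divfK ?gt_eqF //.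
  move: H2; rewrite -mulrA; move: Hn; move: (avg _) (_ / n%:R) => *; lra.
move=> HD; have [l2 lk] := andP l2k.
have [a [b ab]] : exists a b : I, a != b.
  have /card_gt1P[a [b [_ _ ab]]] : (1 < #|I|)%N by rewrite card_I; lia.
  by exists a, b.
(* Each half has at least a quarter of the vertices once n >= 2, so up to
   degenerate tuples the correlation is at least d. *)
pose d : R := 4^-1 ^+ k.
have d0 : 0 < d / 4 by rewrite divr_gt0 // exprn_gt0 // invr_gt0.
have [N1 HN1] := Deviation_orthogonal_products lk l2 card_I HD d0.
have [N2 HN2] := exists_div_le (2 * #|I|%:R ^+ 2) d0.
pose n := (maxn N1 (maxn N2 2)).
have [n0 orth] := HN1 n (leq_maxl _ _).
have [_ H2] : (0 < n)%N /\ 2 * #|I|%:R ^+ 2 / n%:R <= d / 4.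
  by apply: HN2; rewrite /n; lia.
have n2 : (2 <= n)%N by rewrite /n; lia.
have V0 : (0 < #|'I_n|)%N by rewrite card_ord.
have [w [w' [wb w'a w1 w'1]]] :=
  @correlated_products R 'I_n I k V0 k_ge3 card_I (sr n).1 (sr n).2 a b ab.
have := orth a b w w' ab wb w'a w1 w'1.
have := avg_noninj R I V0; rewrite card_ord.
have cs : #|(sr n).1| = n./2 by have [] := srP n.
have csC : #|~: (sr n).1| = (n - n./2)%N.
  by have := cardsC (sr n).1; rewrite card_ord cs; move: #|~: _| (n./2) => x y; lia.
have nhalf := odd_double_half n.
have quarter m : (n <= 4 * m)%N -> 4^-1 <= m%:R / n%:R :> R.
  move=> nm; rewrite ler_pdivlMr ?ltr0n // mulrC ler_pdivrMr //.
  by rewrite -natrM ler_nat mulnC.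
have q1 : 4^-1 <= #|~: (sr n).1|%:R / n%:R :> R by apply: quarter; rewrite csC; lia.
have q2 : 4^-1 <= #|(sr n).1|%:R / n%:R :> R by apply: quarter; rewrite cs; lia.
have dle : d <= (#|~: (sr n).1|%:R / n%:R) ^+ (k - 2) * (#|(sr n).1|%:R / n%:R) ^+ 2.
  rewrite /d -(subnK (ltnW k_ge3)) exprD addnK.
  by apply: ler_pM; rewrite ?exprn_ge0 ?invr_ge0 //; apply: lerXn2r;
     rewrite ?nnegrE ?invr_ge0 ?divr_ge0.
move=> Hn Ha Hb.
move: H2; rewrite -mulrA; move: Hn Ha Hb dle.
have : 0 < d by rewrite exprn_gt0 // invr_gt0.
clearbody d; move: d0.
move: (_ ^+ _ * _ ^+ _) (avg (noninj _ (I := _))) (_ / n%:R) => X Y Z.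
move: `|_| => T; lra.
Qed.

End Counterexample.

(** * Clique tests as products over index sets *)
Section CliqueEncoding.
Variables (R : realType) (V : finType) (k l : nat) (E F : {set {set V}}).
Implicit Types (A : {set 'I_k}) (i : 'I_k) (z : {ffun 'I_k -> V}).

Definition clique_sets : {set {set V}} := [set T in ksubsets V k |
   [forall A : {set V}, (A \in ksubsets V l) && (A \subset T) ==> (A \in F)]].

Definition clique_test (A : {set 'I_k}) (z : {ffun 'I_k -> V}) : R :=
  if #|A| == l then (z @: A \in F)%:R else 1.

Lemma norm_clique_test A z : `|clique_test A z| <= 1.
Proof.
by rewrite /clique_test; case: ifP; rewrite ?normr1 // normr_nat lern1 leq_b1.
Qed.

Lemma clique_test_ignores A i : i \notin A -> ignores i (clique_test A).
Proof.
move=> iA z a; rewrite /clique_test; case: ifP => // _.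
have -> // : upd z i a @: A = z @: A.
apply: eq_in_imset => j jA; rewrite updE ifN //.
by apply: contraNneq iA => <-.
Qed.

(** For an injective tuple, index sets of size [l] correspond to [l]-subsets
of its image. *)
Lemma prod_clique_test z : injective z ->
  \prod_A clique_test A z = ([set z i | i : 'I_k] \in clique_sets)%:R.
Proof.
move=> zi; rewrite inE inE card_imset // card_ord eqxx /=.
case: forallP => [H|nH].
  rewrite big1 // => A _; rewrite /clique_test; case: eqP => // Al.
  suff -> : z @: A \in F by [].
  apply: (implyP (H _)); rewrite inE card_imset // Al eqxx.
  by apply/subsetP => _ /imsetP[i _ ->]; rewrite imset_f.
have [B] : exists B, ~~ ((B \in ksubsets V l) && (B \subset [set z i | i : 'I_k])
                         ==> (B \in F)).
  by apply/existsP; rewrite -negb_forall; apply/negP => /forallP.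
rewrite negb_imply => /andP[/andP[Bl Bz] BF].
pose A := z @^-1: B.
have BE : B = z @: A.
  apply/setP => v; apply/idP/imsetP => [vB|[i + ->]]; last by rewrite inE.
  have /imsetP[i _ vi] := subsetP Bz _ vB.
  by exists i; rewrite // inE -vi.
rewrite (bigD1 A) //= /clique_test -BE (negPf BF) ifT ?mul0r //.
by move: Bl; rewrite inE BE card_imset.
Qed.

(** Each k-set is listed by [k`!] injective tuples. *)
Lemma sum_injective (f : {set V} -> R) (K : {set {set V}}) :
  K \subset ksubsets V k ->
  \sum_(z : {ffun 'I_k -> V} | injectiveb z)
    f [set z i | i : 'I_k] * ([set z i | i : 'I_k] \in K)%:R
  = k`!%:R * \sum_(T in K) f T.
Proof.
move=> Kk; pose im (z : {ffun 'I_k -> V}) := [set z i | i : 'I_k].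
transitivity (\sum_(z : {ffun 'I_k -> V} | injectiveb z && (im z \in K)) f (im z)).
  rewrite big_mkcondr; apply: eq_bigr => z _ /=.
  by rewrite -/(im z); case: (im z \in K); rewrite ?mulr1 ?mulr0.
rewrite (partition_big im [in K]) /=; last by move=> z /andP[].
rewrite mulr_sumr; apply: eq_bigr => T TK.
have /eqP Tk : #|T| == k by have := subsetP Kk _ TK; rewrite inE.
rewrite (eq_bigr (fun=> f T)); last by move=> z /andP[_ /eqP <-].
rewrite sumr_const mulr_natl; congr (_ *+ _).
have -> : k`! = (#|T| ^_ #|'I_k|)%N by rewrite Tk card_ord ffactnn.
rewrite -(card_inj_ffuns_on 'I_k [in T]) -[RHS]cardsE; apply: eq_card => z.
rewrite !inE; apply/andP/andP => [[/andP[zi _] /eqP zT]|[zT zi]].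
  by split=> //; apply/ffun_onP => i; rewrite -zT imset_f.
have imz : im z = T.
  apply/eqP; rewrite eqEcard card_imset; last exact/injectiveP.
  rewrite card_ord Tk leqnn andbT; apply/subsetP => _ /imsetP[i _ ->].
  exact: (ffun_onP zT).
by rewrite zi imz TK eqxx.
Qed.

Lemma clique_disc_avg : (0 < #|V|)%N ->
  `|#|E :&: clique_sets|%:R - 2^-1 * #|clique_sets|%:R|
  <= #|V|%:R ^+ k *
     (`|avg (fun z => isign R E z * \prod_A clique_test A z)|
      + avg (@noninj R V 'I_k)).
Proof.
move=> V0; set D := _ - _; set K := clique_sets.
have DE : \sum_(T in K) esign R E T = - 2 * D by rewrite sum_esign.
have Kk : K \subset ksubsets V k by apply/subsetP => T; rewrite inE => /andP[].
have nk : 0 < #|V|%:R ^+ k :> R by rewrite exprn_gt0 // ltr0n.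
pose g z := isign R E z * \prod_A clique_test A z.
have g1 z : `|g z| <= 1.
  rewrite normrM norm_esign mul1r normr_prod prodr_ile1 // => A.
  by rewrite normr_ge0 norm_clique_test.
have sumE : k`!%:R * (- 2 * D)
    = #|V|%:R ^+ k * avg (fun z => g z * (1 - noninj R z)).
  rewrite -DE -(sum_injective (esign R E) Kk) /avg card_ffun card_ord natrX.
  rewrite mulVKf ?gt_eqF // big_mkcond; apply: eq_bigr => z _.
  rewrite /noninj; case: injectiveP => /= zi; last by rewrite subrr mulr0.
  by rewrite subr0 mulr1 /g prod_clique_test.
have le1 : `|D| <= `|k`!%:R * (- 2 * D)|.
  rewrite !normrM normrN !normr_nat mulrA ler_peMl // -natrM ler1n.
  by rewrite muln_gt0 fact_gt0.
apply: le_trans le1 _; rewrite sumE normrM gtr0_norm // ler_wpM2l ?(ltW nk) //.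
rewrite (eq_avg (g := fun z => g z - g z * noninj R z)); last first.
  by move=> z; rewrite mulrBr mulr1.
rewrite avgB; apply: le_trans (ler_normB _ _) _; rewrite lerD2l.
apply: le_trans (ler_norm_avg _) _; apply: ler_avg => z.
by rewrite normrM /noninj normr_nat ler_piMl.
Qed.

End CliqueEncoding.

(** If every other coordinate than [i0] lies in one block, then [i0] is alone
in its block and [i1] can be taken instead. *)
Lemma exists_transverse_slot (p : seq nat) (i0 i1 : slot p) :
  (3 <= sumn p)%N -> (2 <= size p)%N -> all (fun i => 0 < i)%N p -> i0 != i1 ->
  exists2 i, i \in [set i0; i1] & forall j, exists2 i', i' != i & tag i' != j.
Proof.
move=> p3 t2 /allP p0 i01.
have [off|] := boolP [forall j, [exists i' : slot p, (i' != i0) && (tag i' != j)]].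
  exists i0; first by rewrite !inE eqxx.
  by move=> j; have /existsP[i' /andP[]] := forallP off j; exists i'.
rewrite negb_forall => /existsP[j]; rewrite negb_exists => /forallP in_j.
have {}in_j i' : i' != i0 -> tag i' = j.
  by move=> i'0; have := in_j i'; rewrite i'0 /= negbK => /eqP.
have i1j : tag i1 = j by apply: in_j; rewrite eq_sym.
have i0j : tag i0 != j.
  have [j' j'j] : exists j' : 'I_(size p), j' != j.
    have [|q [q' [_ _ qq']]] := @card_gt1P _ [set: 'I_(size p)] _.
      by rewrite cardsT card_ord.
    have [qj|] := eqVneq q j; last by exists q.
    by exists q'; rewrite eq_sym -qj.
  have q0 : (0 < nth 0%N p j')%N by apply/p0/mem_nth.
  pose i : slot p := Tagged (fun j : 'I_(size p) => 'I_(nth 0%N p j)) (Ordinal q0).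
  have [<-|/in_j ij] := eqVneq i i0; first by [].
  by rewrite -ij eqxx in j'j.
exists i1; first by rewrite !inE eqxx orbT.
move=> j''; have [->|jj''] := eqVneq j'' j; first by exists i0.
have [i2] : exists i2, i2 \in ~: [set i0; i1].
  apply/set0Pn; rewrite -card_gt0; have := cardsC [set i0; i1].
  by rewrite card_slot cards2 i01; move: #|~: _| => x; lia.
rewrite !inE negb_or => /andP[i20 i21]; exists i2 => //.
by rewrite in_j // eq_sym.
Qed.

Lemma Expand_not_Deviation (R : realType) k p l :
  (3 <= k)%N -> (2 <= l <= k)%N -> proper_partition k p ->
  seq_not_implies (@Expand R k p) (@Deviation R k l).
Proof.
move=> k3 lk /and3P[t2 p0 /eqP pk].
have cI : #|slot p| = k by rewrite card_slot.
have [H [tests noDev]] := exists_facet_parity_sequence R k3 cI.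
exists H; split; last exact: noDev.
apply: Expand_from_averages => // eps e0.
have [N HN] := tests _ e0; exists N => n /HN[n0 Hn]; split=> // v0 S.
apply: Hn => [j z|i0 i1 i01]; first by rewrite normr_nat lern1 leq_b1.
have [i ii iP] : exists2 i, i \in [set i0; i1] &
    forall j, exists2 i', i' != i & tag i' != j.
  by apply: exists_transverse_slot; rewrite ?pk.
exists i => // j; have [i' i'i i'j] := iP j; exists i' => // z a.
by rewrite block_test_ignores.
Qed.

Lemma CliqueDisc_not_Deviation (R : realType) k l l' :
  (3 <= k)%N -> (2 <= l <= k)%N -> (1 <= l' <= k - 2)%N ->
  seq_not_implies (@CliqueDisc R k l') (@Deviation R k l).
Proof.
move=> k3 lk /andP[l'1 l'k].
have [H [tests noDev]] := exists_facet_parity_sequence R k3 (card_ord k).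
exists H; split; last exact: noDev.
pose Q n (F : {set {set vertices H n}}) : R :=
  #|edges (hgraph H n) :&: clique_sets k l' F|%:R
  - 2^-1 * #|clique_sets k l' F|%:R.
have [eps e0|err err_o errP] := @exists_uniform_littleo R k _ Q; last first.
  by exists err => // n G; apply: errP.
have e2 : 0 < eps / 2 by rewrite divr_gt0.
have [N1 HN1] := tests _ e2.
have [N2 HN2] := exists_div_le (k%:R ^+ 2) e2.
exists (maxn N1 N2) => n; rewrite geq_max => /andP[/HN1[n0 H1] /HN2[_ H2]] F.
have V0 := card_vertices_gt0 H n0.
apply: le_trans (clique_disc_avg _ _ _ _ _ V0) _.
rewrite card_vertices mulrC ler_wpM2r ?exprn_ge0 //.
rewrite [leRHS]splitr; apply: lerD; last first.
  apply: le_trans (avg_noninj _ _ V0) _.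
  by rewrite card_vertices card_ord.
apply: H1 => [A z|i0 i1 i01]; first exact: norm_clique_test.
exists i0; first by rewrite !inE eqxx.
move=> A; have [Al|Al] := eqVneq #|A| l'.
  have [j] : exists j, j \in ~: (i0 |: A).
    apply/set0Pn; rewrite -card_gt0; have := cardsC (i0 |: A).
    rewrite card_ord cardsU1 Al; case: (i0 \notin A) => /=;
      move: #|~: _| => x; lia.
  rewrite !inE negb_or => /andP[ji0 jA]; exists j => //.
  exact: clique_test_ignores.
exists i1; first by rewrite eq_sym.
by move=> z a; rewrite /clique_test (negPf Al).
Qed.

Theorem theorem5 (R : realType) (k : nat) (hk : (3 <= k)%N) :
  (forall (l : nat) (p : seq nat),
     (2 <= l <= k)%N -> proper_partition k p ->
     seq_implies (@Deviation R k l) (@Expand R k p))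
  /\ seq_implies (@CliqueDisc R k (k - 1)%N) (@Deviation R k k)
  /\ (forall l : nat, (2 <= l <= k)%N ->
       (forall p : seq nat, proper_partition k p ->
          seq_not_implies (@Expand R k p) (@Deviation R k l))
       /\ (forall l' : nat, (1 <= l' <= k - 2)%N ->
          seq_not_implies (@CliqueDisc R k l') (@Deviation R k l))).
Proof.
split; first by move=> l p lk pk H; apply: Deviation_Expand.
split; first by move=> H; apply: CliqueDisc_Deviation.
move=> l lk; split=> [p pk|l' l'k]; first exact: Expand_not_Deviation.
exact: CliqueDisc_not_Deviation.
Qed.
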